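(* Let $a$ be a complex number with $\operatorname{Re} a>0$. Then $$\int_0^\infty \frac{\sin x}{\cosh ax+\cos x}\,\frac{x\,dx}{x^2-\pi^2}=\tan^{-1}\!\left(\frac1a\right)-\frac1a.$$
   Context: $\tan^{-1}$ denotes the principal branch of the arctangent. The singularity of the integrand at $x=\pi$ is removable. *)

(* Defs.v *)
From Stdlib Require Import Reals Lra.
From Coquelicot Require Import Coquelicot.
Open Scope R_scope.

Definition Cexp (z : C) : C :=
  (exp (Re z) * cos (Im z), exp (Re z) * sin (Im z)).

Definition Ccosh (z : C) : C :=
  ((Cexp z + Cexp (- z)) / RtoC 2)%C.

(* Principal argument, with values in (-PI, PI]; the value at 0 is irrelevant. *)
Definition Carg (z : C) : R :=
  if Rle_dec 0 (Im z) then acos (Re z / Cmod z) else - acos (Re z / Cmod z).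

Definition Cln (z : C) : C := (ln (Cmod z), Carg z).

(* Principal branch of the arctangent: analytic off the two cuts
   {i t : t real, |t| >= 1}, and equal to atan on the real line. *)
Definition Catan (z : C) : C :=
  ((Cln (RtoC 1 + Ci * z) - Cln (RtoC 1 - Ci * z)) / (RtoC 2 * Ci))%C.

(* Since Re a > 0, the denominator [cosh (a x) + cos x] has no zero for x >= 0.
   Inversion being total, this function takes the value 0 at the removable
   singularity x = PI; a Riemann integral does not depend on the value of the
   integrand at a single point. *)
Definition integrand (a : C) (x : R) : C :=
  (RtoC (sin x) / (Ccosh (a * RtoC x) + RtoC (cos x))
   * RtoC (x / (x ^ 2 - PI ^ 2)))%C.

(* Sanity checks on the branch of the logarithm and of the arctangent. *)

Lemma Re_div_Cmod_bound (z : C) : z <> RtoC 0 -> -1 <= Re z / Cmod z <= 1.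
Proof.
intros hz.
assert (hm := proj1 (Cmod_gt_0 z) hz).
assert (h : Rabs (Re z) <= Cmod z).
{ eapply Rle_trans; [apply Rmax_l | apply (Rmax_Cmod z)]. }
apply Rabs_le_between in h.
split.
- apply Rle_div_r; lra.
- apply Rle_div_l; lra.
Qed.

Lemma Cmod_sqr (z : C) : Cmod z ^ 2 = Re z ^ 2 + Im z ^ 2.
Proof.
unfold Cmod. rewrite pow2_sqrt; [reflexivity |].
apply Rplus_le_le_0_compat; apply pow2_ge_0.
Qed.

Lemma Carg_bound (z : C) : z <> RtoC 0 -> - PI < Carg z <= PI.
Proof.
intros hz.
assert (hm := proj1 (Cmod_gt_0 z) hz).
assert (hb := Re_div_Cmod_bound z hz).
assert (ha := acos_bound (Re z / Cmod z)).
assert (hpi := PI_RGT_0).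
unfold Carg. destruct (Rle_dec 0 (Im z)) as [h | h]; [lra |].
assert (hq := Cmod_sqr z).
assert (-1 < Re z / Cmod z < 1) as hs.
{ assert (Im z < 0) by lra.
  split; [apply Rlt_div_r | apply Rlt_div_l]; nra. }
assert (h2 := acos_bound_lt _ hs). lra.
Qed.

Lemma Cexp_Cln (z : C) : z <> RtoC 0 -> Cexp (Cln z) = z.
Proof.
intros hz.
assert (hm := proj1 (Cmod_gt_0 z) hz).
assert (hb := Re_div_Cmod_bound z hz).
assert (hq := Cmod_sqr z).
assert (hs : sqrt (1 - (Re z / Cmod z)²) = Rabs (Im z) / Cmod z).
{ replace (1 - (Re z / Cmod z)²) with ((Rabs (Im z) / Cmod z)²).
  - apply sqrt_Rsqr. apply Rdiv_le_0_compat; [apply Rabs_pos | exact hm].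
  - unfold Rdiv. rewrite !Rsqr_mult, <- Rsqr_abs, Rsqr_inv'.
    unfold Rsqr. field_simplify_eq; lra. }
assert (hC : cos (Carg z) = Re z / Cmod z).
{ unfold Carg. destruct (Rle_dec 0 (Im z)); rewrite ?cos_neg;
  now apply cos_acos. }
assert (hS : sin (Carg z) = Im z / Cmod z).
{ unfold Carg. destruct (Rle_dec 0 (Im z)) as [h | h].
  - rewrite sin_acos, hs, Rabs_pos_eq by assumption. reflexivity.
  - rewrite sin_neg, sin_acos, hs, Rabs_left by (assumption || lra).
    field. lra. }
unfold Cexp, Cln. change (Re (?u, ?v)) with u. change (Im (?u, ?v)) with v.
simpl (Re _). simpl (Im _).
rewrite exp_ln, hC, hS by exact hm.
destruct z as [x y]. simpl Re. simpl Im. f_equal; field; lra.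
Qed.

Lemma Carg_1 (x : R) : Carg (1, x) = atan x.
Proof.
assert (hb := atan_bound x).
assert (hpi := PI_RGT_0).
assert (hc : Re (1, x) / Cmod (1, x) = cos (atan x)).
{ rewrite cos_atan. unfold Cmod, Rsqr. simpl.
  replace (1 * (1 * 1) + x * (x * 1)) with (1 + x * x) by ring. reflexivity. }
unfold Carg. rewrite hc. simpl Im.
destruct (Rle_dec 0 x) as [h | h].
- apply acos_cos. split; [| lra].
  destruct h as [h | <-]; [| rewrite atan_0; lra].
  rewrite <- atan_0. left. now apply atan_increasing.
- rewrite <- cos_neg, acos_cos; [ring |].
  assert (atan x < atan 0) by (apply atan_increasing; lra).
  rewrite atan_0 in *. lra.
Qed.

Lemma Catan_RtoC (x : R) : Catan (RtoC x) = RtoC (atan x).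
Proof.
unfold Catan.
replace (RtoC 1 + Ci * RtoC x)%C with ((1, x) : C)
  by (apply injective_projections; simpl; ring).
replace (RtoC 1 - Ci * RtoC x)%C with ((1, - x) : C)
  by (apply injective_projections; simpl; ring).
unfold Cln. rewrite !Carg_1, atan_opp.
replace (Cmod (1, - x)) with (Cmod (1, x))
  by (unfold Cmod; f_equal; simpl; ring).
apply injective_projections; simpl; field.
Qed.

(* Main.v *)
(* With q = exp (-ax), expanding in powers of q gives
     sin x / (cosh ax + cos x) = 2 sum_{n>=1} (-1)^(n-1) q^n sin nx,
   and (-1)^n x sin nx / (x^2 - PI^2) = n K_n(nx), where
     K_n(t) = int_0^1 cos(ts) cos(n PI s) ds
   has no singularity.  Substituting t = nx in the n-th term turns the integral
   into -2 sum_n int_0^oo exp(-at) K_n(t) dt.  The sum K_0 + 2 sum_{n<=N} K_n is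
   the N-th partial Fourier sum at 0 of s |-> cos(ts), so it tends to 1, with an
   error O(t^2 / N); hence the integral is int_0^oo exp(-at) (sin t / t - 1) dt.
   Differentiating int_0^oo exp(-at) sin(ut)/t dt in u identifies the first half
   of it with the arctangent. *)
Require Import Defs.
From Stdlib Require Import Reals Lra Lia.
From Coquelicot Require Import Coquelicot.
Open Scope R_scope.

(** The interchange of sum and integral is delicate at x = 0, where |q| = 1 and the geometric bound
    gives nothing. Everything is therefore done on a finite [0, X] with N terms, and N tends to
    infinity before X does. The remainder after N terms has a closed form, because (-1)^n sin nx
    satisfies a linear recurrence whose coefficients are those of the denominator 1 + 2q cos x +
    q^2; its integral over [0, X] is O(1/N). After t = nx the n-th term lives on [0, nX], so the
    kernels do not share an interval. Extending all of them to [0, NX] costs a geometric series of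
    ratio exp(-X Re a). This is the only error that survives N -> oo, and it vanishes as X -> oo.
    The estimates use a only through |exp(-at)| = exp(-t Re a), so complex a is treated directly,
    without analytic continuation from the real axis. *)

(** * The nonsingular kernels: bounds, continuity and closed form *)

Definition cos_kernel (b t : R) : R := RInt (fun s => cos (t * s) * cos (b * s)) 0 1.

Lemma continuous_of_ex_derive (f : R -> R) (x : R) : ex_derive f x -> continuous f x.
Proof. exact (ex_derive_continuous f x). Qed.

Lemma is_RInt_cos_kernel (b t : R) :
  is_RInt (fun s => cos (t * s) * cos (b * s)) 0 1 (cos_kernel b t).
Proof.
apply (RInt_correct (V := R_CompleteNormedModule)), (ex_RInt_continuous (V := R_CompleteNormedModule)).
intros s _. apply continuous_of_ex_derive. auto_derive. easy.
Qed.

Lemma Rabs_cos_le (x : R) : Rabs (cos x) <= 1.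
Proof. apply Rabs_le, COS_bound. Qed.

Lemma Rabs_sin_le (x : R) : Rabs (sin x) <= 1.
Proof. apply Rabs_le, SIN_bound. Qed.

Lemma cos_lipschitz (x y : R) : Rabs (cos x - cos y) <= Rabs (x - y).
Proof.
rewrite <- (Rmult_1_l (Rabs (x - y))).
apply (bounded_variation cos (fun u => - sin u)).
intros u _. split.
- auto_derive; [easy | ring].
- rewrite Rabs_Ropp. apply Rabs_sin_le.
Qed.

Lemma cos_kernel_bound (b t : R) : Rabs (cos_kernel b t) <= 1.
Proof.
replace 1 with ((1 - 0) * 1) by ring.
apply (norm_RInt_le_const (V := R_NormedModule) _ 0 1 _ 1 Rle_0_1) with (2 := is_RInt_cos_kernel b t).
intros s _. change (Rabs (cos (t * s) * cos (b * s)) <= 1).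
rewrite Rabs_mult, <- (Rmult_1_l 1).
apply Rmult_le_compat; auto using Rabs_pos, Rabs_cos_le.
Qed.

(** The integral form gives continuity at every t, including t = b and t = -b, where the closed form
    [cos_kernel_eq] is 0/0. *)
Lemma cos_kernel_lipschitz (b t u : R) : Rabs (cos_kernel b t - cos_kernel b u) <= Rabs (t - u).
Proof.
replace (Rabs (t - u)) with ((1 - 0) * Rabs (t - u)) by ring.
apply (norm_RInt_le_const (V := R_NormedModule) (fun s => cos (t * s) * cos (b * s) - cos (u * s) * cos (b * s)) 0 1 _ (Rabs (t - u)) Rle_0_1).
2: exact (is_RInt_minus (V := R_NormedModule) _ _ _ _ _ _ (is_RInt_cos_kernel b t) (is_RInt_cos_kernel b u)).
intros s hs. change (Rabs (cos (t * s) * cos (b * s) - cos (u * s) * cos (b * s)) <= Rabs (t - u)).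
rewrite <- Rmult_minus_distr_r, Rabs_mult, <- (Rmult_1_r (Rabs (t - u))).
apply Rmult_le_compat; auto using Rabs_pos, Rabs_cos_le.
eapply Rle_trans; [apply cos_lipschitz |].
rewrite <- Rmult_minus_distr_r, Rabs_mult, (Rabs_pos_eq s) by lra.
assert (h := Rabs_pos (t - u)). nra.
Qed.

Lemma continuous_of_lipschitz (f : R -> R) (x : R) :
  (forall y, Rabs (f y - f x) <= Rabs (y - x)) -> continuous f x.
Proof.
intros h. apply filterlim_locally. intros eps. exists eps. intros y hy.
change (Rabs (f y - f x) < eps). eapply Rle_lt_trans; [apply h | exact hy].
Qed.

Lemma continuous_cos_kernel (b t : R) : continuous (cos_kernel b) t.
Proof. apply continuous_of_lipschitz. intros u. apply cos_kernel_lipschitz. Qed.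

Lemma cos_kernel_eq (b t : R) : t ^ 2 <> b ^ 2 ->
  cos_kernel b t = (t * sin t * cos b - b * cos t * sin b) / (t ^ 2 - b ^ 2).
Proof.
intros h. apply (is_RInt_unique (V := R_CompleteNormedModule)).
set (g := fun s => (t * sin (t * s) * cos (b * s) - b * cos (t * s) * sin (b * s)) / (t ^ 2 - b ^ 2)).
replace (_ / _) with (minus (g 1) (g 0)).
- apply (is_RInt_derive (V := R_CompleteNormedModule)).
  + intros s _. unfold g. auto_derive; [lra | field; lra].
  + intros s _. apply continuous_of_ex_derive. auto_derive. easy.
- unfold g, minus, plus, opp. simpl. rewrite !Rmult_0_r, !Rmult_1_r, sin_0. field. lra.
Qed.

(** * Partial Fourier sums at 0 and their rate of convergence *)

Fixpoint dirichlet (N : nat) (s : R) : R :=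
  match N with
  | O => 1
  | S n => dirichlet n s + 2 * cos (INR (S n) * PI * s)
  end.

Lemma sin_half_dirichlet (N : nat) (s : R) :
  sin (PI / 2 * s) * dirichlet N s = sin ((INR N + / 2) * PI * s).
Proof.
induction N as [| n IH].
- simpl. rewrite Rmult_1_r. f_equal. field.
- change (dirichlet (S n) s) with (dirichlet n s + 2 * cos (INR (S n) * PI * s)).
  rewrite Rmult_plus_distr_l, IH, S_INR.
  replace ((INR n + / 2) * PI * s) with ((INR n + 1) * PI * s - PI / 2 * s) by field.
  replace ((INR n + 1 + / 2) * PI * s) with ((INR n + 1) * PI * s + PI / 2 * s) by field.
  rewrite sin_minus, sin_plus. ring.
Qed.

(* [cos_kernel b] is the half-sum of the sinc functions centred at b and -b, so this is the sum of sinc(t - n PI) over |n| <= N. *)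
Fixpoint sincsum (N : nat) (t : R) : R :=
  match N with
  | O => cos_kernel 0 t
  | S n => sincsum n t + 2 * cos_kernel (INR (S n) * PI) t
  end.

Lemma is_RInt_sincsum (N : nat) (t : R) :
  is_RInt (fun s => cos (t * s) * dirichlet N s) 0 1 (sincsum N t).
Proof.
induction N as [| n IH].
- eapply is_RInt_ext; [| apply is_RInt_cos_kernel].
  intros s _. simpl. now rewrite Rmult_0_l, cos_0.
- eapply is_RInt_ext.
  2: exact (is_RInt_plus (V := R_NormedModule) _ _ _ _ _ _ IH
       (is_RInt_scal (V := R_NormedModule) _ _ _ 2 _ (is_RInt_cos_kernel (INR (S n) * PI) t))).
  intros s _. change (dirichlet (S n) s) with (dirichlet n s + 2 * cos (INR (S n) * PI * s)).
  unfold plus, scal. simpl. unfold mult. simpl. ring.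
Qed.

Lemma sin_INR_PI (n : nat) : sin (INR n * PI) = 0.
Proof.
induction n as [| n IH]; [simpl; rewrite Rmult_0_l; apply sin_0 |].
rewrite S_INR, Rmult_plus_distr_r, Rmult_1_l, neg_sin, IH. ring.
Qed.

Lemma cos_kernel_0_0 : cos_kernel 0 0 = 1.
Proof.
apply (is_RInt_unique (V := R_CompleteNormedModule)).
apply is_RInt_ext with (fun _ => 1).
- intros s _. now rewrite Rmult_0_l, cos_0, Rmult_1_r.
- assert (h := is_RInt_const (V := R_NormedModule) 0 1 1).
  unfold scal in h. simpl in h. unfold mult in h. simpl in h.
  rewrite Rminus_0_r, Rmult_1_r in h. exact h.
Qed.

(** The Dirichlet kernel has integral 1 over [0, 1]. Hence 1 - [sincsum N t] is the integral of (1 -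
    cos ts) [dirichlet N s], whose first factor vanishes to second order at s = 0. *)
Lemma sincsum_0 (N : nat) : sincsum N 0 = 1.
Proof.
induction N as [| n IH]; [apply cos_kernel_0_0 |].
change (sincsum n 0 + 2 * cos_kernel (INR (S n) * PI) 0 = 1). rewrite IH, cos_kernel_eq.
- rewrite sin_INR_PI. unfold Rdiv. ring.
- assert (h := PI_RGT_0). assert (h' := lt_0_INR (S n) (Nat.lt_0_succ n)).
  assert (0 < INR (S n) * PI) by now apply Rmult_lt_0_compat. nra.
Qed.

Lemma Rabs_sin_le_Rabs (x : R) : Rabs (sin x) <= Rabs x.
Proof.
assert (hb := bounded_variation sin cos 1 0 x).
rewrite sin_0, !Rminus_0_r, Rmult_1_l in hb. apply hb.
intros u _. split; [auto_derive; [easy | ring] | apply Rabs_cos_le].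
Qed.

Lemma one_minus_cos_bound (x : R) : 0 <= 1 - cos x <= x ^ 2 / 2.
Proof.
split; [generalize (COS_bound x); lra |].
replace x with (2 * (x / 2)) at 1 by field.
rewrite cos_2a_sin.
assert (h := Rabs_sin_le_Rabs (x / 2)).
apply Rsqr_le_abs_1 in h. unfold Rsqr in h. lra.
Qed.

(** With y = PI s / 2 >= s: up to y = PI/6 the cosine is at least cos(PI/3) = 1/2, so sin y >= y/2;
    beyond it sin y >= 1/2 >= s/2. *)
Lemma sin_half_PI_ge (s : R) : 0 <= s <= 1 -> s / 2 <= sin (PI / 2 * s).
Proof.
intros hs. assert (hp := PI_RGT_0). assert (hp2 := PI2_3_2).
set (y := PI / 2 * s).
assert (hy : s <= y <= PI / 2) by (unfold y; nra).
destruct (Rle_dec y (PI / 6)) as [h | h].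
- destruct (MVT_gen sin 0 y cos) as [c [hc he]].
  + intros x _. auto_derive; [easy | ring].
  + intros x _. apply continuity_sin.
  + rewrite Rmin_left, Rmax_right in hc by lra. rewrite sin_0, !Rminus_0_r in he.
    rewrite he. assert (/ 2 <= cos c); [| nra].
    replace (/ 2) with (cos (PI / 3)) by (rewrite cos_PI3; field).
    apply cos_decr_1; lra.
- assert (sin (PI / 6) <= sin y) by (apply sin_incr_1; lra).
  rewrite sin_PI6 in *. lra.
Qed.

(* The quotient (1 - cos ts)/sin(PI s/2) has derivative O(t^2) on (0, 1), so
   one integration by parts against sin((N+1/2) PI s) gains a factor 1/N; the
   mean value theorem applied to [W] performs it without a limit at [s = 0]. *)
Lemma sincsum_bound (N : nat) (t : R) :
  Rabs (1 - sincsum N t) <= 8 * t ^ 2 / (INR N + / 2).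
Proof.
assert (hp := PI_RGT_0). assert (hp4 := PI_4). assert (hN := pos_INR N).
set (M := (INR N + / 2) * PI).
set (u := fun s => 1 - cos (t * s)).
set (v := fun s => sin (PI / 2 * s)).
(* Both [u] and [v] vanish at 0; the expression [h 0] evaluates to 0, which is also the limit of
   [h], so [W] below is continuous at that endpoint. *)
set (h := fun s => u s / v s).
set (dh := fun s => (t * sin (t * s) * v s - u s * (PI / 2 * cos (PI / 2 * s))) / (v s) ^ 2).
set (w := fun s => u s * dirichlet N s).
assert (hw : forall s, continuous w s).
{ intros s. apply (continuous_mult (K := R_AbsRing)).
  - apply continuous_of_ex_derive. unfold u. auto_derive. easy.
  - apply continuous_of_ex_derive. clear. induction N as [| n IH].
    + apply ex_derive_const.
    + apply (ex_derive_plus (K := R_AbsRing) (V := R_NormedModule)); [exact IH | auto_derive; easy]. }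
set (G := fun s => RInt w 0 s : R).
assert (hG : forall s, is_derive G s (w s)).
{ intros s. apply (is_derive_RInt (V := R_NormedModule) w G 0 s); [| apply hw].
  apply filter_forall. intros y. apply (RInt_correct (V := R_CompleteNormedModule)).
  apply (ex_RInt_continuous (V := R_CompleteNormedModule)). intros z _. apply hw. }
assert (hG1 : G 1 = 1 - sincsum N t).
{ apply (is_RInt_unique (V := R_CompleteNormedModule)).
  assert (h0 := is_RInt_sincsum N 0). rewrite sincsum_0 in h0.
  eapply is_RInt_ext.
  2: exact (is_RInt_minus (V := R_NormedModule) _ _ _ _ _ _ h0 (is_RInt_sincsum N t)).
  intros s _. unfold w, u, minus, plus, opp. simpl. rewrite Rmult_0_l, cos_0. ring. }
(* On (0, 1), [w s] = sin(Ms) [h s], so differentiating the second summand cancels the derivative of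
   [G] and leaves cos(Ms) [dh s] / M, which is O(t^2 / M). *)
set (W := fun s => G s + cos (M * s) * h s / M).
assert (hMpos : 0 < M) by (unfold M; nra).
assert (hv : forall s, 0 < s <= 1 -> 0 < v s).
{ intros s hs. apply Rlt_le_trans with (s / 2); [lra |]. apply sin_half_PI_ge. lra. }
assert (hh : forall s, 0 <= s <= 1 -> Rabs (h s) <= t ^ 2 * s).
{ intros s [[h1 | <-] h2].
  - unfold h. assert (hu := one_minus_cos_bound (t * s)). fold (u s) in hu.
    assert (hvs := hv s (conj h1 h2)).
    assert (s / 2 <= v s) by (apply sin_half_PI_ge; lra).
    rewrite Rabs_pos_eq by (apply Rdiv_le_0_compat; lra).
    apply Rle_div_l; [lra |]. apply Rle_trans with (t ^ 2 * s * (s / 2)); [nra |].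
    apply Rmult_le_compat_l; [nra | lra].
  - unfold h, u. rewrite !Rmult_0_r, cos_0, Rminus_diag. unfold Rdiv. rewrite Rmult_0_l, Rabs_R0. lra. }
assert (hdW : forall s, 0 < s < 1 -> is_derive W s (cos (M * s) * dh s / M)).
{ intros s hs. assert (hvs := hv s ltac:(lra)).
  assert (hdir : w s = sin (M * s) * h s).
  { unfold w, h, M. rewrite <- sin_half_dirichlet. fold (v s). field. lra. }
  unfold W.
  replace (cos (M * s) * dh s / M) with (plus (w s) (cos (M * s) * dh s / M - sin (M * s) * h s)).
  2: { rewrite hdir. unfold plus. simpl. ring. }
  apply (is_derive_plus (K := R_AbsRing) (V := R_NormedModule)); [apply hG |].
  unfold h, dh, u, v in *. auto_derive.
  - repeat split; lra.
  - field. lra. }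
(* The numerator is at most 3 t^2 s^2 and [v s] ^ 2 >= s^2 / 4, which gives 12 t^2. The endpoint 0
   is included because the mean value point is only known to lie in the closed interval. *)
assert (hdh : forall s, 0 <= s <= 1 -> Rabs (dh s) <= 15 * t ^ 2).
{ intros s [[hs0 | <-] hs1].
  2: { unfold dh, u. rewrite !Rmult_0_r, sin_0, cos_0, Rminus_diag, !Rmult_0_r, !Rmult_0_l.
    rewrite Rminus_diag. unfold Rdiv. rewrite Rmult_0_l, Rabs_R0. nra. }
  assert (hvs := hv s ltac:(lra)).
  assert (hv1 : s / 2 <= v s) by (apply sin_half_PI_ge; lra).
  assert (hv2 : v s <= 2 * s).
  { assert (hb := Rabs_sin_le_Rabs (PI / 2 * s)). fold (v s) in hb.
    rewrite !Rabs_pos_eq in hb by nra. nra. }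
  assert (hu := one_minus_cos_bound (t * s)). fold (u s) in hu.
  assert (h1 : Rabs (t * sin (t * s)) <= t ^ 2 * s).
  { rewrite Rabs_mult. assert (hb := Rabs_sin_le_Rabs (t * s)).
    rewrite Rabs_mult, (Rabs_pos_eq s) in hb by lra.
    assert (ht := Rabs_pos t). rewrite <- (pow2_abs t). nra. }
  assert (h2 : Rabs (PI / 2 * cos (PI / 2 * s)) <= 2).
  { rewrite Rabs_mult, (Rabs_pos_eq (PI / 2)) by lra.
    assert (hc := Rabs_cos_le (PI / 2 * s)). nra. }
  unfold dh. rewrite Rabs_div by (apply pow_nonzero; lra).
  rewrite (Rabs_pos_eq (v s ^ 2)) by nra.
  apply Rle_div_l; [nra |].
  apply Rle_trans with (3 * (t ^ 2 * s ^ 2)).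
  - unfold Rminus. eapply Rle_trans; [apply Rabs_triang |]. rewrite Rabs_Ropp, !Rabs_mult.
    rewrite <- Rabs_mult, (Rabs_pos_eq (v s)), (Rabs_pos_eq (u s)), <- Rabs_mult by lra.
    assert (Rabs (t * sin (t * s)) * v s <= t ^ 2 * s * (2 * s)).
    { apply Rmult_le_compat; try lra. apply Rabs_pos. }
    assert (u s * Rabs (PI / 2 * cos (PI / 2 * s)) <= (t * s) ^ 2 / 2 * 2).
    { apply Rmult_le_compat; try lra. apply Rabs_pos. }
    nra.
  - assert (s ^ 2 <= 4 * v s ^ 2) by nra.
    assert (0 <= t ^ 2) by nra. nra. }
assert (hcW : forall s, 0 <= s <= 1 -> continuity_pt W s).
{ intros s hs. apply continuity_pt_filterlim.
  destruct hs as [[h1 | <-] h2].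
  - apply (continuous_plus (K := R_AbsRing) (V := R_NormedModule)).
    + apply continuous_of_ex_derive. eexists. apply hG.
    + apply continuous_of_ex_derive. assert (hvs := hv s (conj h1 h2)).
      unfold h, u, v in *. auto_derive. repeat split; lra.
  - apply (continuous_plus (K := R_AbsRing) (V := R_NormedModule)).
    + apply continuous_of_ex_derive. eexists. apply hG.
    + apply filterlim_locally. intros eps.
      assert (hd : 0 < Rmin 1 (eps * M / (t ^ 2 + 1))).
      { apply Rmin_glb_lt; [lra |]. apply Rdiv_lt_0_compat; [| nra].
        apply Rmult_lt_0_compat; [apply cond_pos | lra]. }
      exists (mkposreal _ hd). intros y hy.
      assert (hy1 : Rabs y < Rmin 1 (eps * M / (t ^ 2 + 1))).
      { rewrite <- (Rminus_0_r y). exact hy. }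
      assert (hyl := Rlt_le_trans _ _ _ hy1 (Rmin_l _ _)).
      assert (hyr := Rlt_le_trans _ _ _ hy1 (Rmin_r _ _)).
      apply Rlt_div_r in hyr; [| nra].
      assert (hhy : Rabs (h y) <= t ^ 2 * Rabs y).
      { destruct (Rle_dec 0 y) as [hy0 | hy0].
        - rewrite (Rabs_pos_eq y) in * by lra. apply hh. lra.
        - rewrite (Rabs_left y) in * by lra.
          (* Continuity at 0 is two-sided while [hh] covers s >= 0 only; [h] is odd. *)
          replace (h y) with (- h (- y)).
          + rewrite Rabs_Ropp. apply hh. lra.
          + unfold h, u, v. rewrite !Ropp_mult_distr_r_reverse, cos_neg, sin_neg, Rdiv_opp_r. ring. }
      change (Rabs (cos (M * y) * h y / M - cos (M * 0) * h 0 / M) < eps).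
      assert (h0 := hh 0 ltac:(lra)). rewrite Rmult_0_r in h0.
      assert (h00 : h 0 = 0) by (apply Rabs_eq_0; generalize (Rabs_pos (h 0)); lra).
      rewrite h00. unfold Rdiv at 2. rewrite Rmult_0_r, Rmult_0_l, Rminus_0_r.
      rewrite Rabs_div, (Rabs_pos_eq M) by lra. apply Rlt_div_l; [lra |].
      rewrite Rabs_mult. assert (hc := Rabs_cos_le (M * y)).
      assert (hc0 := Rabs_pos (cos (M * y))). assert (hh0 := Rabs_pos (h y)).
      assert (hy0 := Rabs_pos y). nra. }
destruct (MVT_gen W 0 1 (fun s => cos (M * s) * dh s / M)) as [c [hc he]].
- intros s. rewrite Rmin_left, Rmax_right by lra. apply hdW.
- intros s. rewrite Rmin_left, Rmax_right by lra. apply hcW.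
- rewrite Rmin_left, Rmax_right in hc by lra.
  assert (h00 := hh 0 ltac:(lra)). rewrite Rmult_0_r in h00.
  assert (h0 : h 0 = 0) by (apply Rabs_eq_0; generalize (Rabs_pos (h 0)); lra).
  assert (hW0 : W 0 = 0).
  { unfold W, G. rewrite h0, RInt_point. unfold zero. simpl. field. lra. }
  assert (hG1' : 1 - sincsum N t = (cos (M * c) * dh c - cos (M * 1) * h 1) / M).
  { rewrite <- hG1. rewrite hW0 in he. unfold W in he. field_simplify_eq; [| lra].
    apply (f_equal (fun z => z * M)) in he. field_simplify in he; [| lra | lra]. lra. }
  rewrite hG1', Rabs_div, (Rabs_pos_eq M) by lra.
  assert (h1 := hh 1 ltac:(lra)). assert (h2 := hdh c hc).
  (* 15 comes from [dh c] and 1 from [h 1]; then 16 <= 8 PI turns 16 t^2 / M into the stated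
     bound. *)
  assert (h3 : Rabs (cos (M * c) * dh c - cos (M * 1) * h 1) <= 16 * t ^ 2).
  { unfold Rminus. eapply Rle_trans; [apply Rabs_triang |]. rewrite Rabs_Ropp, !Rabs_mult.
    assert (h4 := Rabs_cos_le (M * c)). assert (h5 := Rabs_cos_le (M * 1)).
    assert (h6 := Rabs_pos (cos (M * c))). assert (h7 := Rabs_pos (cos (M * 1))).
    assert (h8 := Rabs_pos (h 1)). assert (h9 := Rabs_pos (dh c)). nra. }
  assert (hp2 := PI2_3_2). apply Rle_div_l; [lra |].
  apply (Rle_trans _ _ _ h3). unfold M.
  replace (8 * t ^ 2 / (INR N + / 2) * ((INR N + / 2) * PI)) with (8 * t ^ 2 * PI) by (field; lra).
  assert (ht := pow2_ge_0 t). nra.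
Qed.

(** * The complex exponential exp(-ct) and its integral *)

Definition Cexp_decay (c : C) (t : R) : C := Cexp (- (c * RtoC t)).

Lemma Cexp_decay_pair (c : C) (t : R) :
  Cexp_decay c t = (exp (- (Re c * t)) * cos (Im c * t), - (exp (- (Re c * t)) * sin (Im c * t))).
Proof.
unfold Cexp_decay, Cexp.
replace (Re (- (c * RtoC t))) with (- (Re c * t)) by (destruct c; simpl; ring).
replace (Im (- (c * RtoC t))) with (- (Im c * t)) by (destruct c; simpl; ring).
rewrite cos_neg, sin_neg. f_equal. ring.
Qed.

Lemma Cmod_Cexp_decay (c : C) (t : R) : Cmod (Cexp_decay c t) = exp (- (Re c * t)).
Proof.
rewrite Cexp_decay_pair. unfold Cmod. simpl fst. simpl snd.
rewrite <- (sqrt_pow2 (exp (- (Re c * t)))) at 3 by (left; apply exp_pos).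
f_equal. assert (h := sin2_cos2 (Im c * t)). unfold Rsqr in h.
rewrite <- (Rmult_1_r (exp _ ^ 2)), <- h. ring.
Qed.

Lemma Cexp_plus (y z : C) : Cexp (y + z) = (Cexp y * Cexp z)%C.
Proof.
unfold Cexp. destruct y, z. simpl. rewrite exp_plus, cos_plus, sin_plus.
apply injective_projections; simpl; ring.
Qed.

Lemma Cexp_decay_plus (c : C) (s t : R) : Cexp_decay c (s + t) = (Cexp_decay c s * Cexp_decay c t)%C.
Proof. unfold Cexp_decay. rewrite <- Cexp_plus, RtoC_plus. f_equal. ring. Qed.

Lemma Cexp_decay_0 (c : C) : Cexp_decay c 0 = RtoC 1.
Proof.
rewrite Cexp_decay_pair, !Rmult_0_r, Ropp_0, exp_0, cos_0, sin_0.
apply injective_projections; simpl; ring.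
Qed.

Lemma continuous_C (f : R -> C) (x : R) :
  continuous (fun t => fst (f t)) x -> continuous (fun t => snd (f t)) x ->
  continuous (f : R -> C_R_NormedModule) x.
Proof.
intros h1 h2. apply filterlim_locally. intros eps.
apply filterlim_locally with (eps := eps) in h1.
apply filterlim_locally with (eps := eps) in h2.
generalize (filter_and _ _ h1 h2). apply filter_imp. intros y hy. exact hy.
Qed.

Lemma continuous_Cexp_decay (c : C) (t : R) : continuous (Cexp_decay c : R -> C_R_NormedModule) t.
Proof.
apply continuous_C.
- apply continuous_ext with (fun t => exp (- (Re c * t)) * cos (Im c * t)).
  + intros s. now rewrite Cexp_decay_pair.
  + apply continuous_of_ex_derive. auto_derive. easy.
- apply continuous_ext with (fun t => - (exp (- (Re c * t)) * sin (Im c * t))).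
  + intros s. now rewrite Cexp_decay_pair.
  + apply continuous_of_ex_derive. auto_derive. easy.
Qed.

Lemma Cmod2_pos (c : C) : 0 < Re c -> 0 < Re c ^ 2 + Im c ^ 2.
Proof. intros h. nra. Qed.

Lemma Re_pos_neq_0 (c : C) : 0 < Re c -> c <> RtoC 0.
Proof. intros h ->. simpl in h. lra. Qed.

Lemma is_RInt_Cexp_decay (c : C) (Y : R) : 0 < Re c ->
  is_RInt (V := C_R_NormedModule) (Cexp_decay c) 0 Y ((RtoC 1 - Cexp_decay c Y) / c)%C.
Proof.
intros hc. assert (hm := Cmod2_pos c hc).
set (m := Re c ^ 2 + Im c ^ 2) in *.
(* [g1] and [g2] are the real and imaginary parts of -exp(-ct)/c. *)
set (g1 := fun t => - (exp (- (Re c * t)) * (Re c * cos (Im c * t) - Im c * sin (Im c * t))) / m).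
set (g2 := fun t => exp (- (Re c * t)) * (Im c * cos (Im c * t) + Re c * sin (Im c * t)) / m).
replace ((RtoC 1 - Cexp_decay c Y) / c)%C with (g1 Y - g1 0, g2 Y - g2 0).
- apply (is_RInt_fct_extend_pair (U := R_NormedModule) (V := R_NormedModule)).
  + apply is_RInt_ext with (fun t => exp (- (Re c * t)) * cos (Im c * t)).
    * intros s _. now rewrite Cexp_decay_pair.
    * apply (is_RInt_derive (V := R_CompleteNormedModule) g1).
      -- intros s _. unfold g1. auto_derive; [easy |]. unfold m in *. field. lra.
      -- intros s _. apply continuous_of_ex_derive. auto_derive. easy.
  + apply is_RInt_ext with (fun t => - (exp (- (Re c * t)) * sin (Im c * t))).
    * intros s _. now rewrite Cexp_decay_pair.
    * apply (is_RInt_derive (V := R_CompleteNormedModule) g2).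
      -- intros s _. unfold g2. auto_derive; [easy |]. unfold m in *. field. lra.
      -- intros s _. apply continuous_of_ex_derive. auto_derive. easy.
- rewrite Cexp_decay_pair. unfold g1, g2. rewrite !Rmult_0_r, Ropp_0, exp_0, cos_0, sin_0.
  unfold m in *. destruct c as [x y]. simpl in *.
  apply injective_projections; simpl; field; lra.
Qed.

(** * The truncated Laplace transform of sin t / t *)

(** Serves to differentiate under the integral sign: a quadratic remainder that holds for the
    integrand, uniformly in t, passes to the integral. *)
Lemma is_derive_of_quadratic (f : R -> R) (x l K : R) :
  (forall y, Rabs (f y - f x - (y - x) * l) <= K * (y - x) ^ 2) -> is_derive f x l.
Proof.
intros h. split; [apply is_linear_scal_l |].
intros x' hx'. assert (hx : x = x') by now apply is_filter_lim_locally_unique.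
subst x'. intros eps.
assert (hK : 0 < Rabs K + 1) by (generalize (Rabs_pos K); lra).
exists (mkposreal _ (Rdiv_lt_0_compat _ _ (cond_pos eps) hK)). intros y hy.
change (Rabs (y - x) < eps / (Rabs K + 1)) in hy.
change (Rabs ((f y - f x) - ((y - x) * l)) <= eps * Rabs (y - x)).
eapply Rle_trans; [apply h |]. rewrite <- pow2_abs.
apply Rlt_div_r in hy; [| lra].
assert (h0 := Rabs_pos (y - x)). assert (hK' := Rle_abs K). 
replace (K * Rabs (y - x) ^ 2) with ((K * Rabs (y - x)) * Rabs (y - x)) by ring.
apply Rmult_le_compat_r; [easy | nra].
Qed.

Lemma sin_quadratic (x y : R) : Rabs (sin x - sin y - (x - y) * cos y) <= (x - y) ^ 2.
Proof.
destruct (MVT_gen sin y x cos) as [c [hc he]].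
- intros z _. auto_derive; [easy | ring].
- intros z _. apply continuity_sin.
- rewrite he.
  replace (cos c * (x - y) - (x - y) * cos y) with ((x - y) * (cos c - cos y)) by ring.
  rewrite Rabs_mult, <- pow2_abs. simpl. rewrite Rmult_1_r.
  apply Rmult_le_compat_l; [apply Rabs_pos |].
  eapply Rle_trans; [apply cos_lipschitz |].
  unfold Rmin, Rmax in hc. destruct (Rle_dec y x); unfold Rabs; do 2 destruct Rcase_abs; lra.
Qed.

Lemma mult_cos_kernel_0 (t : R) : t * cos_kernel 0 t = sin t.
Proof.
destruct (Req_dec t 0) as [-> | h]; [rewrite sin_0; ring |].
rewrite cos_kernel_eq by nra. rewrite cos_0. field. nra.
Qed.

(** [u * cos_kernel 0 (u * t)] is sin(ut)/t, extended by u at t = 0; its u-derivative is cos(ut).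
    The estimate is [sin_quadratic] divided by t. *)
Lemma sinc_quadratic (u v t : R) :
  Rabs (v * cos_kernel 0 (v * t) - u * cos_kernel 0 (u * t) - (v - u) * cos (u * t)) <= Rabs t * (v - u) ^ 2.
Proof.
destruct (Req_dec t 0) as [-> | h].
- rewrite !Rmult_0_r, cos_kernel_0_0, cos_0, Rabs_R0.
  match goal with |- Rabs ?e <= _ => replace e with 0 by ring end. rewrite Rabs_R0. lra.
- assert (ht := Rabs_pos_lt t h).
  apply Rmult_le_reg_l with (Rabs t); [easy |]. rewrite <- Rabs_mult.
  replace (t * _) with (sin (v * t) - sin (u * t) - (v * t - u * t) * cos (u * t))
    by (rewrite <- !mult_cos_kernel_0; ring).
  eapply Rle_trans; [apply sin_quadratic |].
  rewrite <- Rmult_assoc, <- Rabs_mult, (Rabs_pos_eq (t * t)) by nra. right. ring.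
Qed.

Lemma exp_le_compat (x y : R) : x <= y -> exp x <= exp y.
Proof. intros [h | ->]; [left; now apply exp_increasing | apply Rle_refl]. Qed.

Lemma ex_RInt_scal_Cexp_decay (f : R -> R) (c : C) (x y : R) :
  (forall t, continuous f t) ->
  ex_RInt (V := C_R_CompleteNormedModule) (fun t => scal (f t) (Cexp_decay c t)) x y.
Proof.
intros hf. apply (ex_RInt_continuous (V := C_R_CompleteNormedModule)). intros t _.
apply (continuous_scal (K := R_AbsRing) (V := C_R_NormedModule)); [apply hf | apply continuous_Cexp_decay].
Qed.

Lemma scal_C_R (r : R) (z : C) : scal r (z : C_R_NormedModule) = (RtoC r * z)%C.
Proof.
destruct z. apply injective_projections; simpl; unfold scal; simpl; unfold mult; simpl; ring.
Qed.

Lemma norm_scal_Cexp_decay (r : R) (c : C) (t : R) :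
  norm (scal r (Cexp_decay c t : C_R_NormedModule)) = Rabs r * exp (- (Re c * t)).
Proof.
now rewrite scal_C_R, <- Cmod_norm, Cmod_mult, Cmod_R, Cmod_Cexp_decay.
Qed.

(** The pairs are a - iu and a + iu, and cos(ut) exp(-at) is the half-sum of the exponentials with
    these two rates. *)
Lemma is_RInt_cos_Cexp_decay (a : C) (u Y : R) : 0 < Re a ->
  is_RInt (V := C_R_NormedModule) (fun t => scal (cos (u * t)) (Cexp_decay a t)) 0 Y
    (RtoC (/ 2) * ((RtoC 1 - Cexp_decay (Re a, Im a - u)%R Y) / (Re a, Im a - u)%R
                   + (RtoC 1 - Cexp_decay (Re a, Im a + u)%R Y) / (Re a, Im a + u)%R))%C.
Proof.
intros ha. rewrite <- scal_C_R.
eapply is_RInt_ext.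
2: apply is_RInt_scal, (is_RInt_plus (V := C_R_NormedModule)); apply is_RInt_Cexp_decay; exact ha.
intros t _. rewrite !Cexp_decay_pair.
simpl Re. simpl Im. rewrite Rmult_minus_distr_r, Rmult_plus_distr_r, cos_minus, cos_plus, sin_minus, sin_plus.
apply injective_projections; simpl; unfold plus, scal; simpl; unfold mult; simpl; field.
Qed.

Lemma Rabs_fst_le_Cmod (z : C) : Rabs (fst z) <= Cmod z.
Proof. eapply Rle_trans; [apply Rmax_l | apply Rmax_Cmod]. Qed.

Lemma Rabs_snd_le_Cmod (z : C) : Rabs (snd z) <= Cmod z.
Proof. eapply Rle_trans; [apply Rmax_r | apply Rmax_Cmod]. Qed.

Lemma Cmod_le_sum (z : C) : Cmod z <= Rabs (fst z) + Rabs (snd z).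
Proof.
replace z with (RtoC (fst z) + Ci * RtoC (snd z))%C at 1.
- eapply Rle_trans; [apply Cmod_triangle |]. rewrite Cmod_mult, !Cmod_R.
  replace (Cmod Ci) with 1; [lra |]. symmetry.
  transitivity (sqrt 1); [unfold Cmod; f_equal; simpl; ring | apply sqrt_1].
- destruct z. apply injective_projections; simpl; ring.
Qed.

(* The value of [Catan (u / a)], written so that its derivative in the real variable [u] exists on both sides of 0. *)
Definition atan_path (a : C) (u : R) : C :=
  (/ 2 * (atan ((Im a + u) / Re a) - atan ((Im a - u) / Re a)),
   - / 4 * (ln (Re a ^ 2 + (Im a + u) ^ 2) - ln (Re a ^ 2 + (Im a - u) ^ 2))).

(** This is a / (a^2 + u^2) in partial fractions, the derivative of arctan(u/a). *)
Definition atan_path_der (a : C) (u : R) : C :=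
  (RtoC (/ 2) * (RtoC 1 / (Re a, Im a - u)%R + RtoC 1 / (Re a, Im a + u)%R))%C.

Lemma is_derive_atan_path (a : C) (u : R) : 0 < Re a ->
  is_derive (fun v => fst (atan_path a v)) u (fst (atan_path_der a u)) /\
  is_derive (fun v => snd (atan_path a v)) u (snd (atan_path_der a u)).
Proof.
intros ha. destruct a as [x y]. simpl in ha.
assert (hx := pow_lt x 2 ha).
assert (h1 : 0 < x ^ 2 + (y + u) ^ 2) by (generalize (pow2_ge_0 (y + u)); lra).
assert (h2 : 0 < x ^ 2 + (y - u) ^ 2) by (generalize (pow2_ge_0 (y - u)); lra).
split; simpl; unfold plus, scal; simpl; unfold mult; simpl.
- auto_derive; [easy |]. unfold Rsqr. field. repeat split; nra.
- auto_derive; [simpl in h1, h2; repeat split; lra |]. field. repeat split; nra.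
Qed.

(** The integral [G u] of exp(-at) sin(ut)/t over [0, Y] has derivative [L u], which differs from
    the derivative of [atan_path] by a tail at Y. Both functions vanish at u = 0, so the mean value
    inequality on [0, 1] bounds their difference at u = 1. It is applied to real and imaginary parts
    separately, whence the factor 2. *)
Lemma sinc_laplace (a : C) (Y : R) : 0 < Re a -> 0 <= Y ->
  Cmod (RInt (V := C_R_CompleteNormedModule) (fun t => scal (cos_kernel 0 t) (Cexp_decay a t)) 0 Y
        - atan_path a 1)%C <= 2 * (exp (- (Re a * Y)) / Re a).
Proof.
intros ha hY.
set (f := fun u t => scal (u * cos_kernel 0 (u * t)) (Cexp_decay a t : C_R_NormedModule)).
set (G := fun u => RInt (V := C_R_CompleteNormedModule) (f u) 0 Y : C).
set (L := fun u => (RtoC (/ 2) * ((RtoC 1 - Cexp_decay (Re a, Im a - u)%R Y) / (Re a, Im a - u)%R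
                   + (RtoC 1 - Cexp_decay (Re a, Im a + u)%R Y) / (Re a, Im a + u)%R))%C).
assert (hf : forall u, is_RInt (V := C_R_NormedModule) (f u) 0 Y (G u)).
{ intros u. apply (RInt_correct (V := C_R_CompleteNormedModule)). apply ex_RInt_scal_Cexp_decay.
  intros t. apply (continuous_mult (K := R_AbsRing)); [apply continuous_const |].
  apply (continuous_comp (fun t => u * t) (cos_kernel 0)); [| apply continuous_cos_kernel].
  apply continuous_of_ex_derive. auto_derive. easy. }
(* One factor Y is the length of the interval, the other bounds the t of [sinc_quadratic]. *)
assert (hq : forall u v, Cmod (G v - G u - RtoC (v - u) * L u)%C <= Y ^ 2 * (v - u) ^ 2).
{ intros u v. rewrite Cmod_norm.
  replace (Y ^ 2 * (v - u) ^ 2) with ((Y - 0) * (Y * (v - u) ^ 2)) by ring.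
  apply (norm_RInt_le_const (V := C_R_NormedModule)
    (fun t => scal (v * cos_kernel 0 (v * t) - u * cos_kernel 0 (u * t) - (v - u) * cos (u * t))
                (Cexp_decay a t : C_R_NormedModule)) 0 Y _ _ hY).
  - intros t ht. rewrite norm_scal_Cexp_decay.
    assert (h := sinc_quadratic u v t). rewrite (Rabs_pos_eq t) in h by lra.
    assert (he : exp (- (Re a * t)) <= 1).
    { rewrite <- exp_0. apply exp_le_compat. nra. }
    assert (h0 := exp_pos (- (Re a * t))). assert (h1 := pow2_ge_0 (v - u)).
    assert (h2 := Rabs_pos (v * cos_kernel 0 (v * t) - u * cos_kernel 0 (u * t) - (v - u) * cos (u * t))).
    apply Rle_trans with (t * (v - u) ^ 2); nra.
  - eapply is_RInt_ext.
    2: { apply (is_RInt_minus (V := C_R_NormedModule)).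
      - apply (is_RInt_minus (V := C_R_NormedModule)); apply hf.
      - replace (RtoC (v - u) * L u)%C with (scal (v - u) (L u : C_R_NormedModule)).
        + apply is_RInt_scal, is_RInt_cos_Cexp_decay, ha.
        + apply scal_C_R. }
    intros t _. unfold f. destruct (Cexp_decay a t).
    apply injective_projections; simpl; unfold minus, plus, opp, scal; simpl; unfold mult; simpl; ring. }
assert (hL : forall u, Cmod (L u - atan_path_der a u) <= exp (- (Re a * Y)) / Re a).
{ intros u.
  assert (hc : forall b, Cmod (Cexp_decay (Re a, b) Y / (Re a, b)%R)%C <= exp (- (Re a * Y)) / Re a).
  { intros b. rewrite Cmod_div by (apply Re_pos_neq_0; exact ha). rewrite Cmod_Cexp_decay.
    apply Rmult_le_compat_l; [left; apply exp_pos |]. apply Rinv_le_contravar; [exact ha |].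
    eapply Rle_trans; [apply Rle_abs |]. apply (Rabs_fst_le_Cmod (Re a, b)). }
  replace (L u - atan_path_der a u)%C
    with (- RtoC (/ 2) * (Cexp_decay (Re a, Im a - u)%R Y / (Re a, Im a - u)%R + Cexp_decay (Re a, Im a + u)%R Y / (Re a, Im a + u)%R))%C.
  - rewrite Cmod_mult, Cmod_opp, Cmod_R, Rabs_pos_eq by lra.
    assert (h := Cmod_triangle (Cexp_decay (Re a, Im a - u)%R Y / (Re a, Im a - u)%R)%C (Cexp_decay (Re a, Im a + u)%R Y / (Re a, Im a + u)%R)%C).
    assert (h1 := hc (Im a - u)). assert (h2 := hc (Im a + u)). lra.
  - unfold L, atan_path_der, Cdiv.
    destruct (Cexp_decay (Re a, Im a - u)%R Y), (Cexp_decay (Re a, Im a + u)%R Y),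
      (/ (Re a, Im a - u)%R)%C, (/ (Re a, Im a + u)%R)%C.
    apply injective_projections; simpl; unfold minus, plus, opp, scal; simpl; unfold mult; simpl; ring. }
assert (hd1 : forall u, is_derive (fun v => fst (G v)) u (fst (L u))).
{ intros u. apply is_derive_of_quadratic with (Y ^ 2). intros v.
  eapply Rle_trans; [| apply hq]. eapply Rle_trans; [| apply Rabs_fst_le_Cmod].
  right. f_equal. simpl. ring. }
assert (hd2 : forall u, is_derive (fun v => snd (G v)) u (snd (L u))).
{ intros u. apply is_derive_of_quadratic with (Y ^ 2). intros v.
  eapply Rle_trans; [| apply hq]. eapply Rle_trans; [| apply Rabs_snd_le_Cmod].
  right. f_equal. simpl. ring. }
assert (hG0 : (G 0 - atan_path a 0)%C = RtoC 0).
{ replace (G 0) with (RtoC 0).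
  - unfold atan_path. rewrite !Rplus_0_r, !Rminus_0_r, !Rminus_diag.
    apply injective_projections; simpl; ring.
  - symmetry. apply (is_RInt_unique (V := C_R_CompleteNormedModule)).
    eapply is_RInt_ext with (fun t => scal 0 (Cexp_decay a t : C_R_NormedModule)).
    + intros t _. unfold f. now rewrite Rmult_0_l.
    + assert (h := is_RInt_scal (V := C_R_NormedModule) _ _ _ 0 _ (is_RInt_Cexp_decay a Y ha)).
      rewrite scal_C_R, Cmult_0_l in h. exact h. }
assert (hG1 : G 1 = RInt (V := C_R_CompleteNormedModule) (fun t => scal (cos_kernel 0 t) (Cexp_decay a t)) 0 Y).
{ unfold G, f. apply (RInt_ext (V := C_R_CompleteNormedModule)). intros t _. now rewrite !Rmult_1_l. }
rewrite <- hG1.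
assert (b1 : Rabs (fst (G 1 - atan_path a 1)%C) <= exp (- (Re a * Y)) / Re a).
{ assert (hb := bounded_variation (fun u => fst (G u - atan_path a u)%C)
    (fun u => fst (L u - atan_path_der a u)%C) (exp (- (Re a * Y)) / Re a) 0 1).
  cbv beta in hb. rewrite hG0 in hb. simpl (fst (RtoC 0)) in hb.
  rewrite !Rminus_0_r, Rabs_R1, Rmult_1_r in hb. apply hb.
  intros u _. split; [| eapply Rle_trans; [apply Rabs_fst_le_Cmod | apply hL]].
  apply (is_derive_minus (V := R_NormedModule)); [apply hd1 | now apply is_derive_atan_path]. }
assert (b2 : Rabs (snd (G 1 - atan_path a 1)%C) <= exp (- (Re a * Y)) / Re a).
{ assert (hb := bounded_variation (fun u => snd (G u - atan_path a u)%C)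
    (fun u => snd (L u - atan_path_der a u)%C) (exp (- (Re a * Y)) / Re a) 0 1).
  cbv beta in hb. rewrite hG0 in hb. simpl (snd (RtoC 0)) in hb.
  rewrite !Rminus_0_r, Rabs_R1, Rmult_1_r in hb. apply hb.
  intros u _. split; [| eapply Rle_trans; [apply Rabs_snd_le_Cmod | apply hL]].
  apply (is_derive_minus (V := R_NormedModule)); [apply hd2 | now apply is_derive_atan_path]. }
eapply Rle_trans; [apply Cmod_le_sum |]. lra.
Qed.

(** * The principal arctangent at 1/a *)

Lemma Cmod_atan (p : C) : 0 < Re p ->
  Re p = Cmod p * cos (atan (Im p / Re p)) /\ Im p = Cmod p * sin (atan (Im p / Re p)).
Proof.
intros hp. assert (hq := Cmod_sqr p).
assert (hs : sqrt (1 + (Im p / Re p)²) = Cmod p / Re p).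
{ replace (1 + (Im p / Re p)²) with ((Cmod p / Re p)²).
  - apply sqrt_Rsqr. apply Rdiv_le_0_compat; [apply Cmod_ge_0 | exact hp].
  - unfold Rsqr. field_simplify_eq; lra. }
assert (hm : 0 < Cmod p) by (apply Cmod_gt_0, Re_pos_neq_0, hp).
rewrite cos_atan, sin_atan, hs. split; field; lra.
Qed.

(** Both angles lie in (-PI/2, PI/2), so their difference lies in (-PI, PI) and needs no correction
    by 2 PI; the sign of its sine selects the case of [Carg]. *)
Lemma Carg_div (p q : C) : 0 < Re p -> 0 < Re q -> Im p / Re p <> Im q / Re q ->
  Carg (p / q) = atan (Im p / Re p) - atan (Im q / Re q).
Proof.
intros hp hq hne.
destruct (Cmod_atan p hp) as [hp1 hp2]. destruct (Cmod_atan q hq) as [hq1 hq2].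
assert (mp : 0 < Cmod p) by (apply Cmod_gt_0, Re_pos_neq_0, hp).
assert (mq : 0 < Cmod q) by (apply Cmod_gt_0, Re_pos_neq_0, hq).
assert (bp := atan_bound (Im p / Re p)). assert (bq := atan_bound (Im q / Re q)).
assert (hpi := PI_RGT_0).
set (x := atan (Im p / Re p)) in *. set (y := atan (Im q / Re q)) in *.
assert (hxy : x <> y).
{ intros h. apply hne. rewrite <- (tan_atan (Im p / Re p)), <- (tan_atan (Im q / Re q)).
  fold x y. now rewrite h. }
assert (hre : Re (p / q) = Cmod p / Cmod q * cos (x - y)).
{ rewrite cos_minus. assert (hs := Cmod_sqr q).
  replace (Re (p / q)) with ((Re p * Re q + Im p * Im q) / (Re q ^ 2 + Im q ^ 2)).
  - rewrite <- hs, hp1, hp2, hq1, hq2. field. lra.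
  - destruct p, q. simpl in *. field. nra. }
assert (him : Im (p / q) = Cmod p / Cmod q * sin (x - y)).
{ rewrite sin_minus. assert (hs := Cmod_sqr q).
  replace (Im (p / q)) with ((Im p * Re q - Re p * Im q) / (Re q ^ 2 + Im q ^ 2)).
  - rewrite <- hs, hp1, hp2, hq1, hq2. field. lra.
  - destruct p, q. simpl in *. field. nra. }
assert (hm : Cmod (p / q) = Cmod p / Cmod q) by (apply Cmod_div, Re_pos_neq_0, hq).
assert (hr : 0 < Cmod p / Cmod q) by now apply Rdiv_lt_0_compat.
unfold Carg. rewrite him, hre, hm.
replace (Cmod p / Cmod q * cos (x - y) / (Cmod p / Cmod q)) with (cos (x - y)) by (field; lra).
destruct (Rle_dec _ _) as [h | h].
- apply acos_cos. split; [| lra]. apply Rnot_lt_le. intros hlt.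
  assert (sin (x - y) < 0) by (apply sin_lt_0_var; lra). nra.
- assert (hlt : x - y < 0).
  { apply Rnot_le_lt. intros hge. apply h. apply Rmult_le_pos; [lra |]. apply sin_ge_0; lra. }
  rewrite <- cos_neg, acos_cos by lra. ring.
Qed.

Lemma ln_Cmod (z : C) : 0 < Re z -> ln (Cmod z) = / 2 * ln (Re z ^ 2 + Im z ^ 2).
Proof.
intros hz. assert (h := Cmod_gt_0 z). rewrite <- Cmod_sqr.
simpl. rewrite Rmult_1_r, ln_mult by (apply h, Re_pos_neq_0, hz). field.
Qed.

(** 1 + i/a and 1 - i/a are (a + i)/a and (a - i)/a, with a, a + i and a - i all in the right
    half-plane. [Carg_div] splits both logarithms and the contributions of a cancel. *)
Lemma Catan_inv (a : C) : 0 < Re a -> Catan (RtoC 1 / a) = atan_path a 1.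
Proof.
intros ha. assert (hne := Re_pos_neq_0 a ha).
assert (h1 : (RtoC 1 + Ci * (RtoC 1 / a))%C = ((Re a, Im a + 1)%R / a)%C).
{ destruct a as [x y]. simpl in ha. apply injective_projections; simpl; field; nra. }
assert (h2 : (RtoC 1 - Ci * (RtoC 1 / a))%C = ((Re a, Im a - 1)%R / a)%C).
{ destruct a as [x y]. simpl in ha. apply injective_projections; simpl; field; nra. }
unfold Catan. rewrite h1, h2. unfold Cln.
assert (hi : forall r s, r <> s -> r / Re a <> s / Re a).
{ intros r s hrs h. apply hrs. apply Rmult_eq_reg_r with (/ Re a); [exact h |].
  apply Rinv_neq_0_compat. lra. }
rewrite !Carg_div by (try exact ha; simpl; apply hi; lra).
rewrite !Cmod_div by exact hne.
assert (hm : forall b, 0 < Cmod (Re a, b)).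
{ intros b. apply Cmod_gt_0, Re_pos_neq_0. exact ha. }
assert (hma : 0 < Cmod a) by now apply Cmod_gt_0.
rewrite !ln_div by auto. rewrite !(ln_Cmod (Re a, _)) by exact ha.
unfold atan_path. simpl Re. simpl Im.
apply injective_projections; simpl; field.
Qed.

Lemma sinc_minus_one_laplace (a : C) (Y : R) : 0 < Re a -> 0 <= Y ->
  Cmod (RInt (V := C_R_CompleteNormedModule) (fun t => scal (cos_kernel 0 t - 1)%R (Cexp_decay a t)) 0 Y
        - (Catan (RtoC 1 / a) - RtoC 1 / a))%C <= 3 * (exp (- (Re a * Y)) / Re a).
Proof.
intros ha hY. assert (hne := Re_pos_neq_0 a ha). rewrite (Catan_inv a ha).
assert (h := sinc_laplace a Y ha hY).
set (S := RInt _ 0 Y) in h.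
assert (hS : is_RInt (V := C_R_NormedModule) (fun t => scal (cos_kernel 0 t) (Cexp_decay a t)) 0 Y S).
{ apply (RInt_correct (V := C_R_CompleteNormedModule)), ex_RInt_scal_Cexp_decay, continuous_cos_kernel. }
rewrite (is_RInt_unique (V := C_R_CompleteNormedModule) _ 0 Y (S - (RtoC 1 - Cexp_decay a Y) / a)%C).
- replace (S - (RtoC 1 - Cexp_decay a Y) / a - (atan_path a 1 - RtoC 1 / a))%C
    with ((S - atan_path a 1) + Cexp_decay a Y / a)%C by (field; exact hne).
  eapply Rle_trans; [apply Cmod_triangle |].
  assert (Cmod (Cexp_decay a Y / a) <= exp (- (Re a * Y)) / Re a); [| lra].
  rewrite Cmod_div, Cmod_Cexp_decay by exact hne.
  apply Rmult_le_compat_l; [left; apply exp_pos |]. apply Rinv_le_contravar; [exact ha |].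
  eapply Rle_trans; [apply Rle_abs |]. apply (Rabs_fst_le_Cmod a).
- eapply is_RInt_ext.
  2: exact (is_RInt_minus (V := C_R_NormedModule) _ _ _ _ _ _ hS (is_RInt_Cexp_decay a Y ha)).
  assert (hz : forall r (z : C_R_NormedModule), minus (scal r z) z = scal (r - 1) z).
  { intros r [p q].
    apply injective_projections; simpl; unfold minus, plus, opp, scal; simpl; unfold mult; simpl; ring. }
  intros t _. apply hz.
Qed.

(** * The dilated kernels, their recurrence and their size *)

(* K_n(nx) multiplied by n; by [dilated_kernel_eq] this is (-1)^n x sin(nx) / (x^2 - PI^2). *)
Definition dilated_kernel (n : nat) (x : R) : R := INR n * cos_kernel (INR n * PI) (INR n * x).

Lemma cos_kernel_diag (b : R) : b <> 0 -> sin b = 0 -> cos_kernel b b = / 2.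
Proof.
intros hb hs. apply (is_RInt_unique (V := R_CompleteNormedModule)).
set (g := fun s => (b * s + sin (b * s) * cos (b * s)) / (2 * b)).
replace (/ 2) with (minus (g 1) (g 0)).
- apply (is_RInt_derive (V := R_CompleteNormedModule)).
  + intros s _. unfold g. auto_derive; [easy |].
    assert (h := sin2_cos2 (b * s)). unfold Rsqr in h. field_simplify_eq; [| easy].
    replace (sin (b * s) ^ 2) with (1 - cos (b * s) ^ 2) by (rewrite <- h; ring). ring.
  + intros s _. apply continuous_of_ex_derive. auto_derive. easy.
- unfold g, minus, plus, opp. simpl. rewrite Rmult_0_r, Rmult_1_r, sin_0, hs. field. easy.
Qed.

Lemma sqr_neq_PI (x : R) : 0 <= x -> x <> PI -> x ^ 2 <> PI ^ 2.
Proof.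
intros h0 hx h. apply hx. assert (hp := PI_RGT_0).
assert (h' : (x - PI) * (x + PI) = 0) by lra.
apply Rmult_integral in h'. lra.
Qed.

Lemma dilated_kernel_eq (n : nat) (x : R) : 0 <= x -> x <> PI ->
  dilated_kernel n x = cos (INR n * PI) * sin (INR n * x) * (x / (x ^ 2 - PI ^ 2)).
Proof.
intros h0 hx. assert (h := sqr_neq_PI x h0 hx). unfold dilated_kernel.
destruct n as [| n].
- simpl. rewrite !Rmult_0_l, sin_0. ring.
- assert (hn := lt_0_INR (S n) (Nat.lt_0_succ n)). assert (hs := sin_INR_PI (S n)).
  set (m := INR (S n)) in *.
  rewrite cos_kernel_eq.
  + rewrite hs. field. split; [lra |].
    replace ((m * x) ^ 2 - (m * PI) ^ 2) with (m ^ 2 * (x ^ 2 - PI ^ 2)) by ring.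
    apply Rmult_integral_contrapositive_currified; [apply pow_nonzero |]; lra.
  + intros h'. apply h. apply Rmult_eq_reg_l with (m ^ 2); [lra | apply pow_nonzero; lra].
Qed.

Lemma dilated_kernel_PI (n : nat) : dilated_kernel n PI = INR n / 2.
Proof.
unfold dilated_kernel. destruct n as [| n]; [simpl; field |].
rewrite cos_kernel_diag; [field | | apply sin_INR_PI].
apply Rmult_integral_contrapositive_currified; [| apply PI_neq0].
assert (h := lt_0_INR (S n) (Nat.lt_0_succ n)). lra.
Qed.

(** This is sin (n+2)x + sin nx = 2 cos x sin (n+1)x with the signs (-1)^n inserted; at x = PI it
    holds for the sequence n/2. Its coefficients match those of [qdenom]. *)
Lemma dilated_kernel_rec (n : nat) (x : R) : 0 <= x ->
  dilated_kernel (S (S n)) x + dilated_kernel n x = - 2 * cos x * dilated_kernel (S n) x.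
Proof.
intros h0. destruct (Req_dec x PI) as [-> | hx].
- rewrite !dilated_kernel_PI, !S_INR, cos_PI. field.
- rewrite !dilated_kernel_eq by assumption.
  rewrite !S_INR, !Rmult_plus_distr_r, !Rmult_1_l, !neg_cos, !sin_plus, !cos_plus.
  assert (h := sin2_cos2 x). unfold Rsqr in h.
  set (k := x / _). set (c := cos (INR n * PI)).
  transitivity (c * k * (sin (INR n * x) * (cos x * cos x - sin x * sin x + (sin x * sin x + cos x * cos x))
    + 2 * cos (INR n * x) * sin x * cos x)); [rewrite h |]; ring.
Qed.

(** The bound n from |K_n| <= 1 is too weak: integrated against exp(-n x Re a) it gives O(1),
    whereas 1 + nx gives O(1/n). For x <= 1 the closed form is far from its singularity and bounded
    by 1; for x > 1, n <= nx. *)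
Lemma dilated_kernel_bound (n : nat) (x : R) : 0 <= x -> Rabs (dilated_kernel n x) <= 1 + INR n * x.
Proof.
intros h0. assert (hn := pos_INR n). assert (hp := PI2_3_2).
destruct (Rle_dec x 1) as [h1 | h1].
- apply Rle_trans with 1; [| nra]. rewrite dilated_kernel_eq by lra.
  rewrite !Rabs_mult.
  assert (hq : Rabs (x / (x ^ 2 - PI ^ 2)) <= 1).
  { rewrite Rabs_div by nra. apply Rle_div_l; [apply Rabs_pos_lt; nra |].
    rewrite Rabs_pos_eq, Rabs_left by nra. nra. }
  assert (h2 := Rabs_cos_le (INR n * PI)). assert (h3 := Rabs_sin_le (INR n * x)).
  assert (h4 := Rabs_pos (cos (INR n * PI))). assert (h5 := Rabs_pos (sin (INR n * x))).
  assert (h6 := Rabs_pos (x / (x ^ 2 - PI ^ 2))).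
  rewrite <- (Rmult_1_l 1). apply Rmult_le_compat; try nra.
- unfold dilated_kernel. rewrite Rabs_mult, (Rabs_pos_eq (INR n)) by lra.
  assert (h := cos_kernel_bound (INR n * PI) (INR n * x)). nra.
Qed.

Lemma continuous_dilated_kernel (n : nat) (x : R) : continuous (dilated_kernel n) x.
Proof.
apply (continuous_mult (K := R_AbsRing)); [apply continuous_const |].
apply (continuous_comp (fun t => INR n * t) (cos_kernel _)); [| apply continuous_cos_kernel].
apply continuous_of_ex_derive. auto_derive. easy.
Qed.

(** * Regularity of the integrand and nonvanishing of its denominator *)

Lemma continuous_components (f : R -> C) (x : R) :
  continuous (f : R -> C_R_NormedModule) x ->
  continuous (fun t => fst (f t)) x /\ continuous (fun t => snd (f t)) x.
Proof.
intros hf. split; apply (continuous_comp f _ x hf); destruct (f x).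
- apply (continuous_fst (U := R_UniformSpace) (V := R_UniformSpace)).
- apply (continuous_snd (U := R_UniformSpace) (V := R_UniformSpace)).
Qed.

Lemma continuous_Cmult (f g : R -> C) (x : R) :
  continuous (f : R -> C_R_NormedModule) x -> continuous (g : R -> C_R_NormedModule) x ->
  continuous ((fun t => f t * g t)%C : R -> C_R_NormedModule) x.
Proof.
intros hf hg.
destruct (continuous_components f x hf) as [f1 f2].
destruct (continuous_components g x hg) as [g1 g2].
apply continuous_C.
- apply (continuous_minus (K := R_AbsRing) (V := R_NormedModule));
  now apply (continuous_mult (K := R_AbsRing)).
- apply (continuous_plus (K := R_AbsRing) (V := R_NormedModule));
  now apply (continuous_mult (K := R_AbsRing)).
Qed.

Lemma continuous_Cinv (f : R -> C) (x : R) :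
  continuous (f : R -> C_R_NormedModule) x -> f x <> RtoC 0 ->
  continuous ((fun t => / f t)%C : R -> C_R_NormedModule) x.
Proof.
intros hf hx.
destruct (continuous_components f x hf) as [f1 f2].
assert (hi : continuous (fun t => / (fst (f t) ^ 2 + snd (f t) ^ 2)) x).
{ apply continuous_Rinv_comp.
  - apply (continuous_plus (K := R_AbsRing) (V := R_NormedModule));
    apply (continuous_comp _ (fun y => y ^ 2)); try assumption;
    apply continuous_of_ex_derive; auto_derive; easy.
  - intros h. apply hx. destruct (f x) as [p q]. simpl in h.
    apply injective_projections; simpl; nra. }
apply continuous_C; simpl.
- apply (continuous_mult (K := R_AbsRing)); assumption.
- apply (continuous_mult (K := R_AbsRing)); [| assumption].
  now apply (continuous_opp (K := R_AbsRing) (V := R_NormedModule)).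
Qed.

Lemma continuous_RtoC (f : R -> R) (x : R) : continuous f x ->
  continuous ((fun t => RtoC (f t)) : R -> C_R_NormedModule) x.
Proof. intros hf. apply continuous_C; [exact hf | apply continuous_const]. Qed.

(* The factor in cosh(ax) + cos x = [qdenom a x] / (2 q), q = exp(-ax). *)
Definition qdenom (a : C) (x : R) : C :=
  (RtoC 1 + RtoC (2 * cos x) * Cexp_decay a x + Cexp_decay a x * Cexp_decay a x)%C.

Lemma continuous_qdenom (a : C) (x : R) : continuous (qdenom a : R -> C_R_NormedModule) x.
Proof.
unfold qdenom. apply (continuous_plus (K := R_AbsRing) (V := C_R_NormedModule)).
- apply (continuous_plus (K := R_AbsRing) (V := C_R_NormedModule)).
  + apply continuous_const.
  + apply continuous_Cmult; [apply continuous_RtoC | apply continuous_Cexp_decay].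
    apply continuous_of_ex_derive. auto_derive. easy.
- apply continuous_Cmult; apply continuous_Cexp_decay.
Qed.

(** [qdenom] is the product of these factors for s = sin x and s = - sin x. As (cos x, s) has
    modulus 1, a zero forces |q| = 1, hence x = 0, where the factor is 2. *)
Lemma one_plus_neq_0 (a : C) (x s : R) : 0 < Re a -> 0 <= x ->
  s ^ 2 = sin x ^ 2 -> (RtoC 1 + Cexp_decay a x * (cos x, s)%R)%C <> RtoC 0.
Proof.
intros ha hx hs h.
assert (hz : (Cexp_decay a x * (cos x, s)%R)%C = (- RtoC 1)%C) by (rewrite <- (Cplus_0_l (- RtoC 1)), <- h; ring).
assert (hm := f_equal Cmod hz). rewrite Cmod_opp, Cmod_1, Cmod_mult, Cmod_Cexp_decay in hm.
replace (Cmod (cos x, s)) with 1 in hm.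
- destruct (Req_dec x 0) as [-> | hx0].
  + rewrite Cexp_decay_0, cos_0 in hz. apply (f_equal fst) in hz. simpl in hz. lra.
  + assert (hlt : exp (- (Re a * x)) < 1); [| lra].
    rewrite <- exp_0. apply exp_increasing. assert (0 < x) by lra. nra.
- unfold Cmod. rewrite <- sqrt_1. f_equal. cbv [fst snd]. rewrite hs.
  rewrite <- (sin2_cos2 x). unfold Rsqr. ring.
Qed.

Lemma qdenom_neq_0 (a : C) (x : R) : 0 < Re a -> 0 <= x -> qdenom a x <> RtoC 0.
Proof.
intros ha hx.
replace (qdenom a x) with ((RtoC 1 + Cexp_decay a x * (cos x, sin x)%R) * (RtoC 1 + Cexp_decay a x * (cos x, - sin x)%R))%C.
- apply Cmult_neq_0; apply one_plus_neq_0; try assumption; ring.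
- unfold qdenom. destruct (Cexp_decay a x) as [p q].
  assert (h := sin2_cos2 x). unfold Rsqr in h.
  assert (hc : ((cos x, sin x)%R * (cos x, - sin x)%R)%C = RtoC 1).
  { apply injective_projections; simpl; [rewrite <- h |]; ring. }
  assert (hd : ((cos x, sin x)%R + (cos x, - sin x)%R)%C = RtoC (2 * cos x)).
  { apply injective_projections; simpl; ring. }
  rewrite <- hd.
  transitivity (RtoC 1 + ((cos x, sin x)%R + (cos x, - sin x)%R) * (p, q) +
    (p, q) * (p, q) * ((cos x, sin x)%R * (cos x, - sin x)%R))%C; [ring |].
  rewrite hc. ring.
Qed.

(* The integrand with its removable singularity filled in. *)
Definition regular_integrand (a : C) (x : R) : C :=
  (RtoC (- (2 * dilated_kernel 1 x)) * (Cexp_decay a x * / qdenom a x))%C.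

Lemma continuous_regular_integrand (a : C) (x : R) : 0 < Re a -> 0 <= x ->
  continuous (regular_integrand a : R -> C_R_NormedModule) x.
Proof.
intros ha hx. apply continuous_Cmult.
- apply continuous_RtoC.
  apply (continuous_opp (K := R_AbsRing) (V := R_NormedModule)).
  apply (continuous_mult (K := R_AbsRing)); [apply continuous_const | apply continuous_dilated_kernel].
- apply continuous_Cmult; [apply continuous_Cexp_decay |].
  apply continuous_Cinv; [apply continuous_qdenom | now apply qdenom_neq_0].
Qed.

Lemma integrand_eq_regular_integrand (a : C) (x : R) : 0 < Re a -> 0 <= x -> x <> PI ->
  integrand a x = regular_integrand a x.
Proof.
intros ha hx hpi. assert (hD := qdenom_neq_0 a x ha hx).
assert (hq : Cexp_decay a x <> RtoC 0).
{ apply Cmod_gt_0. rewrite Cmod_Cexp_decay. apply exp_pos. }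
assert (he : Cexp (a * RtoC x) = (/ Cexp_decay a x)%C).
{ assert (h : (Cexp (a * RtoC x) * Cexp_decay a x)%C = RtoC 1).
  { unfold Cexp_decay. rewrite <- Cexp_plus, Cplus_opp_r. unfold Cexp. simpl.
    rewrite exp_0, cos_0, sin_0. apply injective_projections; simpl; ring. }
  apply (f_equal (fun z => z * / Cexp_decay a x)%C) in h.
  rewrite <- Cmult_assoc, Cinv_r, Cmult_1_r, Cmult_1_l in h by exact hq. exact h. }
unfold integrand, regular_integrand.
rewrite dilated_kernel_eq by assumption. simpl INR. rewrite !Rmult_1_l, cos_PI.
replace (Ccosh (a * RtoC x) + RtoC (cos x))%C with (qdenom a x / (RtoC 2 * Cexp_decay a x))%C.
- replace (- (2 * (-1 * sin x * (x / (x ^ 2 - PI ^ 2))))) with (2 * sin x * (x / (x ^ 2 - PI ^ 2))) by ring.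
  rewrite !RtoC_mult. field. repeat split; try assumption.
- unfold Ccosh. rewrite he. fold (Cexp_decay a x). unfold qdenom. rewrite RtoC_mult. field. exact hq.
Qed.

(** * Expansion in powers of q with exact remainder *)

Fixpoint kernel_psum (a : C) (N : nat) (x : R) : C :=
  match N with
  | O => RtoC 0
  | S n => (kernel_psum a n x - RtoC (2 * dilated_kernel (S n) x) * Cexp_decay a (INR (S n) * x))%C
  end.

Lemma Cexp_decay_S (a : C) (n : nat) (x : R) :
  Cexp_decay a (INR (S n) * x) = (Cexp_decay a (INR n * x) * Cexp_decay a x)%C.
Proof. rewrite <- Cexp_decay_plus. f_equal. rewrite S_INR. ring. Qed.

(* The recurrence of [dilated_kernel] telescopes the remainder of the expansion of [regular_integrand]
   in powers of [Cexp_decay a x]. *)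
Lemma regular_integrand_kernel_psum (a : C) (N : nat) (x : R) : 0 < Re a -> 0 <= x ->
  (regular_integrand a x - kernel_psum a N x)%C =
  (RtoC 2 * Cexp_decay a (INR N * x) * Cexp_decay a x
   * (Cexp_decay a x * RtoC (dilated_kernel N x) - RtoC (dilated_kernel (S N) x)) * / qdenom a x)%C.
Proof.
intros ha hx. assert (hD := qdenom_neq_0 a x ha hx).
induction N as [| n IH].
- unfold regular_integrand. simpl INR. rewrite !Rmult_0_l, Cexp_decay_0.
  replace (dilated_kernel 0 x) with 0 by (unfold dilated_kernel; simpl; ring). simpl kernel_psum.
  rewrite RtoC_opp, RtoC_mult. ring.
- simpl kernel_psum. replace (regular_integrand a x - _)%C with ((regular_integrand a x - kernel_psum a n x) + RtoC (2 * dilated_kernel (S n) x) * Cexp_decay a (INR (S n) * x))%C by (simpl; ring).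
  rewrite IH. clear IH.
  assert (hr := dilated_kernel_rec n x hx).
  replace (dilated_kernel (S (S n)) x) with (- 2 * cos x * dilated_kernel (S n) x - dilated_kernel n x) by lra.
  rewrite Cexp_decay_S, RtoC_minus, !RtoC_mult. revert hD. unfold qdenom. rewrite RtoC_mult. intros hD.
  field. exact hD.
Qed.

(* The carrier of [C_R_NormedModule] hides [C] from [ring]. *)
Ltac Cring := match goal with |- ?x = ?y => change (@eq C x y); ring end.

(** * Integral estimates and the limit in N *)

Lemma is_RInt_exp_poly (c p q r x y : R) : 0 < c ->
  is_RInt (fun t => exp (- (c * t)) * (p + q * t + r * t ^ 2)) x y
    (exp (- (c * x)) * ((p + q * x + r * x ^ 2) / c + (q + 2 * r * x) / c ^ 2 + 2 * r / c ^ 3)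
     - exp (- (c * y)) * ((p + q * y + r * y ^ 2) / c + (q + 2 * r * y) / c ^ 2 + 2 * r / c ^ 3)).
Proof.
intros hc.
set (g := fun t => - (exp (- (c * t)) * ((p + q * t + r * t ^ 2) / c + (q + 2 * r * t) / c ^ 2 + 2 * r / c ^ 3))).
replace (_ - _) with (minus (g y) (g x)) by (unfold g, minus, plus, opp; simpl; ring).
apply (is_RInt_derive (V := R_CompleteNormedModule)).
- intros t _. unfold g. auto_derive; [easy |]. field. lra.
- intros t _. apply continuous_of_ex_derive. auto_derive. easy.
Qed.

(** The contribution of the upper end y is dropped by its sign, so the bound is uniform in y. It
    serves for the tails of the kernels, the remainder in q and the Fourier error. *)
Lemma norm_RInt_exp_poly (f : R -> C) (c p q r x y : R) (l : C) :
  0 < c -> 0 <= p -> 0 <= q -> 0 <= r -> 0 <= x <= y ->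
  (forall t, x <= t <= y -> Cmod (f t) <= exp (- (c * t)) * (p + q * t + r * t ^ 2)) ->
  is_RInt (V := C_R_NormedModule) f x y l ->
  Cmod l <= exp (- (c * x)) * ((p + q * x + r * x ^ 2) / c + (q + 2 * r * x) / c ^ 2 + 2 * r / c ^ 3).
Proof.
intros hc hp hq hr hxy hf hl. rewrite Cmod_norm.
eapply Rle_trans.
- apply (norm_RInt_le (V := C_R_NormedModule) f _ x y l _ (proj2 hxy)) with (3 := is_RInt_exp_poly c p q r x y hc).
  + intros t ht. rewrite <- Cmod_norm. now apply hf.
  + exact hl.
- assert (h : 0 <= exp (- (c * y)) * ((p + q * y + r * y ^ 2) / c + (q + 2 * r * y) / c ^ 2 + 2 * r / c ^ 3)); [| lra].
  assert (hy : 0 <= y) by lra.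
  assert (hyy : 0 <= r * y) by nra. assert (hqy : 0 <= q * y) by nra. assert (hr2 : 0 <= r * y ^ 2) by nra.
  apply Rmult_le_pos; [left; apply exp_pos |].
  repeat apply Rplus_le_le_0_compat; apply Rdiv_le_0_compat; try lra; apply pow_lt; lra.
Qed.

Lemma exp_opp_le_inv (y : R) : 0 < y -> exp (- y) <= / y.
Proof.
intros hy. rewrite exp_Ropp. apply Rinv_le_contravar; [exact hy |].
assert (h := exp_ineq1 y ltac:(lra)). lra.
Qed.

Lemma is_RInt_kernel_psum_step (a : C) (n : nat) (X : R) :
  is_RInt (V := C_R_NormedModule)
    (fun x => RtoC (2 * dilated_kernel n x) * Cexp_decay a (INR n * x))%C 0 X
    (RtoC 2 * RInt (V := C_R_CompleteNormedModule)
       (fun t => scal (cos_kernel (INR n * PI) t) (Cexp_decay a t)) 0 (INR n * X))%C.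
Proof.
rewrite <- scal_C_R.
set (F := fun t => scal (cos_kernel (INR n * PI) t) (Cexp_decay a t : C_R_NormedModule)).
assert (h : is_RInt (V := C_R_NormedModule) F (INR n * 0 + 0) (INR n * X + 0)
  (RInt (V := C_R_CompleteNormedModule) F 0 (INR n * X))).
{ rewrite Rmult_0_r, !Rplus_0_r. apply (RInt_correct (V := C_R_CompleteNormedModule)).
  apply ex_RInt_scal_Cexp_decay, continuous_cos_kernel. }
apply is_RInt_comp_lin in h.
eapply is_RInt_ext; [| apply (is_RInt_scal (V := C_R_NormedModule) _ _ _ 2 _ h)].
intros x _. unfold F, dilated_kernel. rewrite Rplus_0_r, !scal_C_R, !RtoC_mult. Cring.
Qed.

(** Extending the n-th term from [0, nX] to [0, Y] costs at most 2 exp(-n X Re a) / Re a. The bound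
    is the exact sum of these costs for n = 1, ..., N, so that the induction step closes by an
    equality. *)
Lemma kernel_psum_sincsum (a : C) (X Y : R) (N : nat) : 0 < Re a -> 0 < X -> INR N * X <= Y ->
  exists p q : C,
  is_RInt (V := C_R_NormedModule) (kernel_psum a N) 0 X p /\
  is_RInt (V := C_R_NormedModule) (fun t => scal (cos_kernel 0 t - sincsum N t) (Cexp_decay a t)) 0 Y q /\
  Cmod (p - q)%C <= 2 / Re a * (exp (- (Re a * X)) * (1 - exp (- (Re a * (INR N * X)))) / (1 - exp (- (Re a * X)))).
Proof.
intros ha hX.
assert (hr : exp (- (Re a * X)) < 1).
{ rewrite <- exp_0. apply exp_increasing. nra. }
assert (hz : is_RInt (V := C_R_NormedModule) (fun _ => RtoC 0) 0 X (RtoC 0)).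
{ assert (h := is_RInt_const (V := C_R_NormedModule) 0 X (RtoC 0)).
  rewrite scal_C_R, Cmult_0_r in h. exact h. }
induction N as [| n IH]; intros hY.
- exists (RtoC 0), (RtoC 0). repeat split.
  + exact hz.
  + assert (h := is_RInt_scal (V := C_R_NormedModule) _ _ _ 0 _ (is_RInt_Cexp_decay a Y ha)).
    rewrite scal_C_R, Cmult_0_l in h.
    eapply is_RInt_ext; [| exact h]. intros t _. simpl sincsum. now rewrite Rminus_diag.
  + replace (RtoC 0 - RtoC 0)%C with (RtoC 0) by ring. rewrite Cmod_0. simpl INR.
    rewrite Rmult_0_l, Rmult_0_r, Ropp_0, exp_0, Rminus_diag. unfold Rdiv. lra.
- rewrite S_INR in hY. destruct IH as [p [q [hp [hq hpq]]]]; [lra |].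
  set (b := INR (S n) * PI).
  set (F := fun t => scal (cos_kernel b t) (Cexp_decay a t : C_R_NormedModule)).
  set (u := RInt (V := C_R_CompleteNormedModule) F 0 (INR (S n) * X) : C).
  set (v := RInt (V := C_R_CompleteNormedModule) F (INR (S n) * X) Y : C).
  assert (hex : forall x y, ex_RInt (V := C_R_CompleteNormedModule) F x y).
  { intros x y. apply ex_RInt_scal_Cexp_decay, continuous_cos_kernel. }
  assert (hv : is_RInt (V := C_R_NormedModule) F (INR (S n) * X) Y v).
  { apply (RInt_correct (V := C_R_CompleteNormedModule)), hex. }
  assert (huv : is_RInt (V := C_R_NormedModule) F 0 Y (u + v)%C).
  { apply (is_RInt_Chasles (V := C_R_NormedModule)) with (INR (S n) * X); [| exact hv].
    apply (RInt_correct (V := C_R_CompleteNormedModule)), hex. }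
  exists (p - RtoC 2 * u)%C, (q - RtoC 2 * (u + v))%C. repeat split.
  + exact (is_RInt_minus (V := C_R_NormedModule) _ _ _ _ _ _ hp (is_RInt_kernel_psum_step a (S n) X)).
  + apply (is_RInt_scal (V := C_R_NormedModule) _ _ _ 2) in huv. rewrite scal_C_R in huv.
    eapply is_RInt_ext; [| exact (is_RInt_minus (V := C_R_NormedModule) _ _ _ _ _ _ hq huv)].
    intros t _. simpl sincsum. fold b. unfold F.
    change (Cminus (scal (cos_kernel 0 t - sincsum n t) (Cexp_decay a t : C_R_NormedModule))
      (scal 2 (scal (cos_kernel b t) (Cexp_decay a t : C_R_NormedModule)))
      = scal (cos_kernel 0 t - (sincsum n t + 2 * cos_kernel b t)) (Cexp_decay a t : C_R_NormedModule)).
    rewrite !scal_C_R. rewrite !RtoC_minus, RtoC_plus, RtoC_mult. Cring.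
  + replace (p - RtoC 2 * u - (q - RtoC 2 * (u + v)))%C with ((p - q) + RtoC 2 * v)%C by ring.
    eapply Rle_trans; [apply Cmod_triangle |]. rewrite Cmod_mult, Cmod_R, (Rabs_pos_eq 2) by lra.
    assert (hvb : Cmod v <= exp (- (Re a * (INR (S n) * X))) / Re a).
    { assert (h0 := pos_INR (S n)).
      assert (h := norm_RInt_exp_poly F (Re a) 1 0 0 (INR (S n) * X) Y v ha).
      eapply Rle_trans; [apply h; try lra |].
      - split; [nra | rewrite S_INR; lra].
      - intros t _. unfold F. rewrite Cmod_norm, norm_scal_Cexp_decay.
        assert (h1 := cos_kernel_bound b t). assert (h2 := exp_pos (- (Re a * t))). nra.
      - exact hv.
      - right. field. lra. }
    assert (he : exp (- (Re a * (INR (S n) * X))) = exp (- (Re a * X)) * exp (- (Re a * (INR n * X)))).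
    { rewrite <- exp_plus. f_equal. rewrite S_INR. ring. }
    apply Rle_trans with (1 := Rplus_le_compat _ _ _ _ hpq (Rmult_le_compat_l 2 _ _ ltac:(lra) hvb)).
    right. rewrite he. field. lra.
Qed.

Lemma regular_integrand_kernel_psum_integral (a : C) (X : R) : 0 < Re a -> 0 < X ->
  exists K, forall N p, (1 <= N)%nat ->
  is_RInt (V := C_R_NormedModule) (kernel_psum a N) 0 X p ->
  Cmod (RInt (V := C_R_CompleteNormedModule) (regular_integrand a) 0 X - p)%C <= K / INR N.
Proof.
intros ha hX.
(* By compactness; thus [B], and with it [K], depends on X, which is harmless since N tends to
   infinity first. *)
assert (hB : exists B, 0 <= B /\ forall x, 0 <= x <= X -> Cmod (/ qdenom a x) <= B).
{ destruct (continuity_ab_maj (fun x => Cmod (/ qdenom a x)) 0 X) as [m [hm _]].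
  - lra.
  - intros x hx. apply continuity_pt_filterlim.
    apply (continuous_ext (T := R_UniformSpace) (U := R_UniformSpace)
      (fun y => @norm R_AbsRing C_R_NormedModule (/ qdenom a y)%C)).
    { intros y. symmetry. apply Cmod_norm. }
    refine (continuous_comp (U := R_UniformSpace) (V := C_R_NormedModule) (W := R_UniformSpace)
      (fun y => (/ qdenom a y)%C) (@norm R_AbsRing C_R_NormedModule) x _ _).
    + apply continuous_Cinv; [apply continuous_qdenom | apply qdenom_neq_0; lra].
    + exact (filterlim_norm (V := C_R_NormedModule) (/ qdenom a x)%C).
  - exists (Cmod (/ qdenom a m)). split; [apply Cmod_ge_0 | exact hm]. }
destruct hB as [B [hB0 hB]].
(* Value of p/c + q/c^2 for c = N Re a, p = 4B, q = 8BN, multiplied by N. *)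
exists (4 * B * (1 / Re a + 2 / Re a ^ 2)). intros N p hN hp.
assert (hN1 : 1 <= INR N) by (apply (le_INR 1); exact hN).
assert (hc : 0 < Re a * INR N) by nra.
assert (hn : is_RInt (V := C_R_NormedModule) (regular_integrand a) 0 X (RInt (V := C_R_CompleteNormedModule) (regular_integrand a) 0 X)).
{ apply (RInt_correct (V := C_R_CompleteNormedModule)), (ex_RInt_continuous (V := C_R_CompleteNormedModule)).
  intros x hx. rewrite Rmin_left in hx by lra. now apply continuous_regular_integrand. }
eapply Rle_trans.
- apply (norm_RInt_exp_poly (fun x => regular_integrand a x - kernel_psum a N x)%C (Re a * INR N) (4 * B) (4 * B * (2 * INR N)) 0 0 X).
  + exact hc.
  + lra.
  + apply Rmult_le_pos; lra.
  + lra.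
  + lra.
  + intros x hx. rewrite regular_integrand_kernel_psum by lra. rewrite !Cmod_mult, Cmod_R, (Rabs_pos_eq 2) by lra.
    rewrite !Cmod_Cexp_decay.
    assert (h1 := exp_pos (- (Re a * (INR N * x)))). assert (h2 := exp_pos (- (Re a * x))).
    assert (h3 : exp (- (Re a * x)) <= 1).
    { rewrite <- exp_0. apply exp_le_compat. nra. }
    assert (h4 : Cmod (Cexp_decay a x * RtoC (dilated_kernel N x) - RtoC (dilated_kernel (S N) x))%C <= 2 * (1 + 2 * INR N * x)).
    { eapply Rle_trans; [apply Cmod_triangle |]. rewrite Cmod_opp, Cmod_mult, !Cmod_R, Cmod_Cexp_decay.
      assert (b1 := dilated_kernel_bound N x (proj1 hx)). assert (b2 := dilated_kernel_bound (S N) x (proj1 hx)).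
      rewrite S_INR in b2. assert (b3 := Rabs_pos (dilated_kernel N x)).
      assert (exp (- (Re a * x)) * Rabs (dilated_kernel N x) <= 1 * Rabs (dilated_kernel N x)) by (apply Rmult_le_compat_r; lra).
      nra. }
    assert (h5 := hB x hx).
    replace (- (Re a * INR N * x)) with (- (Re a * (INR N * x))) by ring.
    set (e := exp (- (Re a * (INR N * x)))) in *. set (e1 := exp (- (Re a * x))) in *.
    set (m := Cmod (Cexp_decay a x * _ - _)) in *. assert (h6 : 0 <= m) by apply Cmod_ge_0.
    assert (h7 : 0 <= Cmod (/ qdenom a x)) by apply Cmod_ge_0.
    apply Rle_trans with (2 * e * 1 * (2 * (1 + 2 * INR N * x)) * B); [| right; ring].
    repeat apply Rmult_le_compat; try lra; repeat apply Rmult_le_pos; lra.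
  + exact (is_RInt_minus (V := C_R_NormedModule) _ _ _ _ _ _ hn hp).
- rewrite !Rmult_0_r, Ropp_0, exp_0. right. field. lra.
Qed.

(** The difference splits as (V - p) + (p - q) + (q - m) + (m - L): remainder in q, extension of the
    intervals, Fourier error, truncation at Y. All but the second are O(1/N) for fixed X. *)
Lemma RInt_regular_integrand_limit (a : C) (X : R) : 0 < Re a -> 1 <= X ->
  Cmod (RInt (V := C_R_CompleteNormedModule) (regular_integrand a) 0 X - (Catan (RtoC 1 / a) - RtoC 1 / a))%C
  <= 2 / Re a * (exp (- (Re a * X)) / (1 - exp (- (Re a * X)))).
Proof.
intros ha hX.
set (V := RInt _ 0 X). set (L := (Catan _ - _)%C).
destruct (regular_integrand_kernel_psum_integral a X ha ltac:(lra)) as [K hK]. fold V in hK.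
set (r := exp (- (Re a * X))).
assert (hr : r < 1).
{ unfold r. rewrite <- exp_0. apply exp_increasing. nra. }
assert (hr0 : 0 < r) by apply exp_pos.
(* 16 / (Re a)^3 is the integral of 8 t^2 exp(-t Re a) over the half-line; 3 / (Re a)^2 comes from
   exp(-y) <= 1/y at y = Y Re a, where Y >= N because X >= 1. *)
set (K' := Rabs K + 16 / Re a ^ 3 + 3 / Re a ^ 2).
assert (hmain : forall N, (1 <= N)%nat -> Cmod (V - L)%C <= 2 / Re a * (r / (1 - r)) + K' / INR N).
{ intros N hN. assert (hN1 : 1 <= INR N) by (apply (le_INR 1); exact hN).
  set (Y := INR N * X). assert (hY : INR N <= Y) by (unfold Y; nra).
  destruct (kernel_psum_sincsum a X Y N ha ltac:(lra) (Rle_refl _)) as [p [q [hp [hq hpq]]]].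
  assert (h1 := hK N p hN hp).
  assert (hm := sinc_minus_one_laplace a Y ha ltac:(lra)). fold L in hm.
  set (m := RInt _ 0 Y) in hm.
  assert (hmi : is_RInt (V := C_R_NormedModule) (fun t => scal (cos_kernel 0 t - 1) (Cexp_decay a t)) 0 Y m).
  { apply (RInt_correct (V := C_R_CompleteNormedModule)), ex_RInt_scal_Cexp_decay. intros t.
    apply (continuous_minus (K := R_AbsRing) (V := R_NormedModule)); [apply continuous_cos_kernel | apply continuous_const]. }
  assert (h2 : Cmod (q - m)%C <= 16 / Re a ^ 3 / INR N).
  { assert (ha3 := pow_lt _ 3 ha).
    eapply Rle_trans.
    - apply (norm_RInt_exp_poly (fun t => scal (1 - sincsum N t) (Cexp_decay a t : C_R_NormedModule)) (Re a) 0 0 (8 / INR N) 0 Y).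
      + exact ha.
      + lra.
      + lra.
      + apply Rdiv_le_0_compat; lra.
      + lra.
      + intros t _. rewrite Cmod_norm, norm_scal_Cexp_decay. rewrite Rmult_comm.
        apply Rmult_le_compat_l; [left; apply exp_pos |].
        eapply Rle_trans; [apply sincsum_bound |].
        assert (8 * t ^ 2 / (INR N + / 2) <= 8 * t ^ 2 / INR N).
        { apply Rmult_le_compat_l; [nra |]. apply Rinv_le_contravar; lra. }
        replace (8 / INR N * t ^ 2) with (8 * t ^ 2 / INR N) by (field; lra). lra.
      + eapply is_RInt_ext; [| exact (is_RInt_minus (V := C_R_NormedModule) _ _ _ _ _ _ hq hmi)].
        intros t _.
        change (Cminus (scal (cos_kernel 0 t - sincsum N t) (Cexp_decay a t : C_R_NormedModule))
          (scal (cos_kernel 0 t - 1) (Cexp_decay a t : C_R_NormedModule))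
          = scal (1 - sincsum N t) (Cexp_decay a t : C_R_NormedModule)).
        rewrite !scal_C_R, !RtoC_minus. Cring.
    - rewrite !Rmult_0_r, Ropp_0, exp_0. right. field. lra. }
  assert (h3 : Cmod (m - L)%C <= 3 / Re a ^ 2 / INR N).
  { eapply Rle_trans; [exact hm |].
    assert (he := exp_opp_le_inv (Re a * Y) ltac:(nra)).
    assert (hi : / (Re a * Y) <= / (Re a * INR N)) by (apply Rinv_le_contravar; nra).
    assert (hia := Rinv_0_lt_compat _ ha).
    apply Rle_trans with (3 * (/ (Re a * INR N) * / Re a)); [unfold Rdiv; nra |].
    right. field. lra. }
  assert (h4 : Cmod (p - q)%C <= 2 / Re a * (r / (1 - r))).
  { eapply Rle_trans; [exact hpq |]. fold Y r.
    apply Rmult_le_compat_l; [apply Rdiv_le_0_compat; lra |].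
    apply Rmult_le_compat_r; [left; apply Rinv_0_lt_compat; lra |].
    assert (h := exp_pos (- (Re a * Y))). nra. }
  replace (V - L)%C with ((V - p) + ((p - q) + ((q - m) + (m - L))))%C by ring.
  assert (t1 := Cmod_triangle (V - p) ((p - q) + ((q - m) + (m - L)))).
  assert (t2 := Cmod_triangle (p - q) ((q - m) + (m - L))).
  assert (t3 := Cmod_triangle (q - m) (m - L)).
  assert (hKK : K / INR N <= Rabs K / INR N).
  { apply Rmult_le_compat_r; [left; apply Rinv_0_lt_compat; lra | apply Rle_abs]. }
  unfold K'. rewrite !Rdiv_plus_distr. lra. }
apply le_epsilon. intros eps heps.
destruct (nfloor_ex (Rabs (K' / eps)) (Rabs_pos _)) as [N hN].
eapply Rle_trans; [apply (hmain (S N)); lia |].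
apply Rplus_le_compat_l. assert (hpos := lt_0_INR (S N) (Nat.lt_0_succ N)).
apply Rle_div_l; [exact hpos |]. rewrite S_INR.
assert (h := Rle_abs (K' / eps)).
assert (hlt : K' / eps < INR N + 1) by lra.
apply Rlt_div_l in hlt; lra.
Qed.

(** * The improper integral *)

Theorem mainTheorem9 (a : C) (ha : 0 < Re a) :
  is_RInt_gen (V := C_R_NormedModule)
    (integrand a) (at_point 0) (Rbar_locally p_infty)
    (Catan (RtoC 1 / a) - RtoC 1 / a)%C.
Proof.
set (L := (Catan _ - _)%C).
assert (hi : forall X, 4 <= X -> is_RInt (V := C_R_NormedModule) (integrand a) 0 X
  (RInt (V := C_R_CompleteNormedModule) (regular_integrand a) 0 X)).
{ intros X hX. assert (hp := PI_4). assert (hp0 := PI_RGT_0).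
  assert (hex : forall x y, 0 <= x <= y -> ex_RInt (V := C_R_CompleteNormedModule) (regular_integrand a) x y).
  { intros x y hxy. apply (ex_RInt_continuous (V := C_R_CompleteNormedModule)).
    intros t ht. rewrite Rmin_left in ht by lra. apply continuous_regular_integrand; lra. }
  assert (hpart : forall x y, 0 <= x <= y -> (y <= PI \/ PI <= x) ->
    is_RInt (V := C_R_NormedModule) (integrand a) x y (RInt (V := C_R_CompleteNormedModule) (regular_integrand a) x y)).
  { intros x y hxy hor.
    apply (is_RInt_ext (V := C_R_NormedModule)) with (regular_integrand a).
    - intros t. rewrite Rmin_left, Rmax_right by lra. intros ht. symmetry. apply integrand_eq_regular_integrand; lra.
    - apply (RInt_correct (V := C_R_CompleteNormedModule)), hex, hxy. }
  (* Cutting at PI makes the singularity an endpoint, and [is_RInt_ext] compares integrands on open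
     intervals only. *)
  rewrite <- (RInt_Chasles (V := C_R_CompleteNormedModule) (regular_integrand a) 0 PI X) by (apply hex; lra).
  apply (is_RInt_Chasles (V := C_R_NormedModule)) with PI; apply hpart; lra. }
intros P [eps hP].
(* With r = exp(-X Re a) <= 1/(X Re a): 4 exceeds PI, 2 / Re a gives r < 1/2, and the last entry
   gives 8 r < eps Re a. *)
set (M := Rmax 4 (Rmax (2 / Re a) (8 / (eps * Re a ^ 2)))).
exists (fun x => x = 0) (fun X => M < X).
- reflexivity.
- now exists M.
- intros x X -> hX. simpl fst. simpl snd.
  assert (m1 : 4 < X) by (eapply Rle_lt_trans; [apply Rmax_l | exact hX]).
  assert (m2 : Rmax (2 / Re a) (8 / (eps * Re a ^ 2)) < X) by (eapply Rle_lt_trans; [apply Rmax_r | exact hX]).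
  assert (m3 : 2 / Re a < X) by (eapply Rle_lt_trans; [apply Rmax_l | exact m2]).
  assert (m4 : 8 / (eps * Re a ^ 2) < X) by (eapply Rle_lt_trans; [apply Rmax_r | exact m2]).
  eexists. split; [apply hi; lra |].
  apply hP. apply (norm_compat1 (V := C_R_NormedModule)).
  change (norm (RInt (V := C_R_CompleteNormedModule) (regular_integrand a) 0 X - L : C_R_NormedModule)%C < eps).
  rewrite <- Cmod_norm.
  eapply Rle_lt_trans; [apply RInt_regular_integrand_limit; lra |].
  set (r := exp (- (Re a * X))).
  assert (heps := cond_pos eps). assert (ha2 := pow_lt _ 2 ha).
  apply Rlt_div_l in m3; [| lra]. apply Rlt_div_l in m4; [| nra].
  assert (haX : 0 < Re a * X) by nra.
  assert (hr : r * (Re a * X) <= 1).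
  { assert (h := exp_opp_le_inv (Re a * X) haX). fold r in h.
    apply Rle_div_r; [exact haX |]. unfold Rdiv. lra. }
  assert (hr0 : 0 < r) by apply exp_pos.
  assert (hr2 : r < / 2) by nra.
  replace (2 / Re a * (r / (1 - r))) with (2 * r / (Re a * (1 - r))) by (field; lra).
  apply Rlt_div_l; [nra |].
  assert (hs : 8 * r < eps * Re a) by nra.
  nra.
Qed.
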